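(* Let $K$ be a field of characteristic zero and let $S=\langle g_1,g_2,g_3,g_4\rangle$ be an $M$-pure symmetric numerical semigroup whose associated graded algebra of the Apéry set $A\cong K[y,z,w]/I$ is not a Complete Intersection. Let $\mu_2,\mu_4$ be the integers with $(\gamma_3+1)g_3=\mu_2g_2+\mu_4g_4\in\mathrm{Ap}(S)$, $1\le\mu_2\le\gamma_2$, $1\le\mu_4\le\gamma_4$, $\mu_2+\mu_4=\gamma_3+1$; let $$\widetilde I=(y^{\gamma_2+1},\ z^{\gamma_3+1}-y^{\mu_2}w^{\mu_4},\ w^{\gamma_4+1}),\qquad G=\frac{K[y,z,w]}{\widetilde I}.$$ Write $G=\bigoplus_{i=0}^{D}G_i$ and $A=\bigoplus_{i=0}^{D-C}A_i$, where $D$ is the socle degree of $G$, $D-C$ is the socle degree of $A$, and $C$ is a positive integer. Set $h_2=\gamma_2-\mu_2+1$, $h_3=\gamma_3-C+1$, $h_4=\gamma_4-\mu_4+1$. Then the defining ideal of $A$ is $$I=\widetilde I+(z^{h_3}y^{h_2},\ z^{h_3}w^{h_4}).$$ Moreover, $$A=\frac{G}{(0:_G z^C)},$$ and therefore $A$ satisfies the Quotient Condition.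
   Context: Let $g_1<g_2<g_3<g_4$ be the minimal generators of $S$, $\gcd=1$, $m=g_1$, and $f=\max(\mathbb N\setminus S)$. $\mathrm{Ap}(S)=\{s\in S:s-g_1\notin S\}=\{0=\omega_1<\cdots<\omega_m=f+g_1\}$. A representation of $s\in S$ is $\lambda\in\mathbb N^4$ with $s=\sum_i\lambda_ig_i$; $\mathrm{ord}(s)$ is the maximum of $\sum\lambda_i$ over representations, and $\lambda$ is maximal if $\sum\lambda_i=\mathrm{ord}(s)$. $S$ is $M$-pure symmetric if for each $i=1,\ldots,m$: $\omega_i+\omega_{m+1-i}=\omega_m$ and $\mathrm{ord}(\omega_i)+\mathrm{ord}(\omega_{m+1-i})=\mathrm{ord}(\omega_m)$. For $i=2,3,4$: $\gamma_i=\max\{h\in\mathbb N: hg_i\in\mathrm{Ap}(S),\ \mathrm{ord}(hg_i)=h,\ hg_i\text{ has a unique maximal representation}\}$. Let $R=K[t^{g_1},\ldots,t^{g_4}]$, $\overline R=R/t^{g_1}R$, $\overline{\mathfrak m}$ its maximal homogeneous ideal. The associated graded algebra of the Apéry set is $A=\mathrm{gr}_{\overline{\mathfrak m}}(\overline R)=\bigoplus_{i\ge0}\overline{\mathfrak m}^i/\overline{\mathfrak m}^{i+1}\cong K[y,z,w]/I$, where $y,z,w$ map to the classes of $t^{g_2},t^{g_3},t^{g_4}$ in $\overline{\mathfrak m}/\overline{\mathfrak m}^2$ and $I$ is the kernel (the defining ideal of $A$). $A$ is a Complete Intersection if $I$ is minimally generated by 3 elements. The socle degree of $A$ is $\mathrm{ord}(f+g_1)$.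 In this setting, integers $\mu_2,\mu_4$ as in the claim exist and $\widetilde I\subsetneq I$; $G$ is a standard graded Artinian Complete Intersection with $D=\gamma_2+\gamma_3+\gamma_4$. A standard graded Artinian $K$-algebra $A$ has the Weak Lefschetz property (WLP) if there is $L\in A_1$ such that each $\times L:A_i\to A_{i+1}$ has maximal rank. Quotient Condition: a standard graded Gorenstein Artinian $K$-algebra $A$ satisfies it if there is a standard graded Gorenstein Artinian $K$-algebra $G$ having the WLP with $A=G/(0:_Gx_l^C)$ for some linear monomial $x_l$ (the image of a variable) and some integer $C\ge0$. *)

(* Defs.v *)
From mathcomp Require Import all_boot all_order all_algebra.
From mathcomp Require Export mpoly.

Set Implicit Arguments.
Unset Strict Implicit.
Unset Printing Implicit Defensive.

Import GRing.Theory.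
Local Open Scope ring_scope.

(** * Numerical semigroups

    A semigroup is given by the tuple [g] of its generators, listed
    increasingly, so that [tnth g ord0] is its multiplicity. *)

Section Semigroup.
Local Open Scope nat_scope.
Variables (n : nat) (g : n.+1.-tuple nat).

(* In a representation of [s] by positive generators every coefficient is at
   most [s], so representations range over a finite type. *)
Definition reps (s : nat) : {set {ffun 'I_n.+1 -> 'I_s.+1}} :=
  [set l : {ffun 'I_n.+1 -> 'I_s.+1} | \sum_i l i * tnth g i == s].

Definition rep_size (s : nat) (l : {ffun 'I_n.+1 -> 'I_s.+1}) : nat :=
  \sum_i l i.

Definition in_sg (s : nat) : bool := reps s != set0.

(* Meaningful for [s] in the semigroup; it is 0 otherwise. *)
Definition sg_ord (s : nat) : nat := \max_(l in reps s) rep_size l.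

Definition max_reps (s : nat) : {set {ffun 'I_n.+1 -> 'I_s.+1}} :=
  [set l in reps s | rep_size l == sg_ord s].

(* The disjunct [s < g_1] is needed because subtraction is truncated. *)
Definition in_apery (s : nat) : bool :=
  in_sg s && ((s < tnth g ord0) || ~~ in_sg (s - tnth g ord0)).

Definition minimal_generators : Prop :=
  [/\ sorted ltn g,
      forall i, 0 < tnth g i,
      \big[gcdn/0]_i tnth g i = 1
    & forall (i : 'I_n.+1) (l : 'I_n.+1 -> nat),
        \sum_j l j * tnth g j = tnth g i -> l i != 0].

(* [w] lists the Apery set increasingly: its entry of index [i] is
   omega_(i+1). *)
Definition M_pure_symmetric : Prop :=
  let m := tnth g ord0 in
  exists w : seq nat,
    [/\ sorted ltn w,
        forall s, (s \in w) = in_apery s,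
        size w = m
      & forall i, i < m ->
          nth 0 w i + nth 0 w (m.-1 - i) = nth 0 w m.-1 /\
          sg_ord (nth 0 w i) + sg_ord (nth 0 w (m.-1 - i))
            = sg_ord (nth 0 w m.-1)].

(* [h] is the integer gamma_i attached to the generator [x = g_i]. *)
Definition is_gamma (x h : nat) : Prop :=
  let P k := [&& in_apery (k * x), sg_ord (k * x) == k
               & #|max_reps (k * x)| == 1] in
  P h /\ forall k, P k -> k <= h.

End Semigroup.

(** * Ideals, as predicates *)

Section Ideals.
Variable T : comNzRingType.
Implicit Types (R X I J : T -> Prop).

Definition ideal_eq I J : Prop := forall p, I p <-> J p.

(* The ideal of the subring [R] of [T] generated by the subset [X] of [R]. *)
Definition ideal_gen R X (p : T) : Prop :=
  exists s : seq (T * T),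
    (forall u, u \in s -> R u.1 /\ X u.2) /\ p = \sum_(u <- s) u.1 * u.2.

Definition ideal_of (gs : seq T) : T -> Prop :=
  ideal_gen (fun=> True) (fun x => x \in gs).

Definition is_ideal I : Prop :=
  [/\ I 0, forall p q, I p -> I q -> I (p + q) & forall a p, I p -> I (a * p)].

Definition ideal_add I J (p : T) : Prop :=
  exists a b, [/\ I a, J b & p = a + b].

(* The preimage in [T] of the ideal (0 : x) of T/I.  Hence the quotient of
   T/I by (0 : x) is T/(colon I x). *)
Definition colon I (x : T) (p : T) : Prop := I (x * p).

Fixpoint ideal_pow R I (k : nat) : T -> Prop :=
  if k is k'.+1 then
    ideal_gen R (fun x => exists a b, [/\ I a, ideal_pow R I k' b & x = a * b])
  else R.

Definition minimally_generated_by (k : nat) I : Prop :=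
  exists gs : k.-tuple T,
    ideal_eq (ideal_of gs) I /\
    forall x, x \in gs -> ~ ideal_eq (ideal_of (rem x gs)) I.

End Ideals.

(** * Standard graded algebras

    The algebra K[x_1, ..., x_n]/J is represented by the ideal J; its component
    of degree d consists of the classes of the homogeneous polynomials of
    degree d. *)

Section Graded.
Variables (K : fieldType) (n : nat).
Implicit Types (J : {mpoly K[n]} -> Prop) (d : nat).

Definition homogeneous_ideal J : Prop :=
  is_ideal J /\ forall p d, J p -> J (pihomog mdeg d p).

Definition standard_graded J : Prop := homogeneous_ideal J /\ ~ J 1.

(* A finitely generated K-algebra is Artinian when it is finite-dimensional. *)
Definition artinian J : Prop :=
  exists s : seq {mpoly K[n]},
    forall p, exists c : nat -> K, J (p - \sum_(i < size s) c i *: s`_i).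

Definition socle J (p : {mpoly K[n]}) : Prop := forall i : 'I_n, J ('X_i * p).

(* An Artinian standard graded algebra is Gorenstein when its socle has
   dimension one. *)
Definition gorenstein_artinian J : Prop :=
  [/\ standard_graded J, artinian J
    & exists s, [/\ socle J s, ~ J s
                  & forall p, socle J p -> exists c : K, J (p - c *: s)]].

Definition socle_degree J d : Prop :=
  (exists p, p \is d.-homog /\ ~ J p) /\
  (forall e p, (d < e)%N -> p \is e.-homog -> J p).

(* Maximal rank: injective or surjective. *)
Definition WLP J : Prop :=
  exists L : {mpoly K[n]}, L \is 1%N.-homog /\
    forall d,
      (forall p, p \is d.-homog -> J (L * p) -> J p) \/
      (forall q, q \is d.+1.-homog ->
         exists p, p \is d.-homog /\ J (q - L * p)).

Definition quotient_condition J : Prop :=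
  gorenstein_artinian J /\
  exists (H : {mpoly K[n]} -> Prop) (l : 'I_n) (C : nat),
    [/\ gorenstein_artinian H, WLP H & ideal_eq J (colon H ('X_l ^+ C))].

End Graded.

(** * The associated graded algebra of the Apery set *)

Section AperyAlgebra.
Variables (K : fieldType) (n : nat) (g : n.+1.-tuple nat).

Definition sg_ring (q : {poly K}) : Prop :=
  exists P : {mpoly K[n.+1]},
    q = mmap (@polyC K) (fun i => 'X^(tnth g i)) P.

Definition sg_max_ideal : {poly K} -> Prop :=
  ideal_gen sg_ring (fun x => exists i, x = 'X^(tnth g i)).

(* The i-th variable goes to t^(g_(i+1)), skipping the first generator. *)
Definition apery_eval (p : {mpoly K[n]}) : {poly K} :=
  mmap (@polyC K) (fun i => 'X^(tnth g (lift ord0 i))) p.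

(* The kernel of the graded map from K[x_1, ..., x_n] to the associated graded
   ring of R/t^(g_1)R, where R = [sg_ring] has maximal ideal m: a form of
   degree d goes to zero iff its value lies in m^(d+1) + t^(g_1)R. *)
Definition apery_ideal (p : {mpoly K[n]}) : Prop :=
  forall d, exists a b,
    [/\ ideal_pow sg_ring sg_max_ideal d.+1 a, sg_ring b
      & apery_eval (pihomog mdeg d p) = a + 'X^(tnth g ord0) * b].

End AperyAlgebra.
Arguments apery_ideal K {n} g p.

Section Variables.
Variable K : fieldType.

Definition vy : {mpoly K[3]} := 'X_(inord 0).
Definition vz : {mpoly K[3]} := 'X_(inord 1).
Definition vw : {mpoly K[3]} := 'X_(inord 2).

Definition I_tilde (gam2 gam3 gam4 mu2 mu4 : nat) : {mpoly K[3]} -> Prop :=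
  ideal_of [:: vy ^+ gam2.+1; vz ^+ gam3.+1 - vy ^+ mu2 * vw ^+ mu4;
               vw ^+ gam4.+1].

End Variables.
Arguments vy {K}.
Arguments vz {K}.
Arguments vw {K}.
Arguments I_tilde K gam2 gam3 gam4 mu2 mu4 : clear implicits.

(* Main.v *)
(** A monomial of K[y,z,w] is either zero in the algebra A or determined there by
    the element of the Apery set that it represents, and A is spanned by these
    classes; G has the same property with respect to the normal forms of the
    rewriting rule z^(gam3+1) -> y^mu2 w^mu4 on the box of exponents at most
    (gam2, gam3, gam4).  Call key the label of the class of a monomial: both
    ideals consist of the polynomials whose coefficients sum to 0 over each set
    of monomials with the same key, and all comparisons of ideals become
    comparisons of keys.  In both algebras the nonzero monomials form a
    cancellative monoid whose elements all divide a top one (for A this is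
    M-pure symmetry), which gives the Gorenstein property.

    Distinct monomials of the box have distinct keys in A, by maximality of the
    gammas, so the top monomial of A is y^gam2 z^beta w^gam4 (it is divisible by
    y^gam2 and w^gam4), while that of G is y^gam2 z^gam3 w^gam4.  By cancellation
    a monomial divides the first iff its product by z^C, C = gam3 - beta, is
    nonzero in G; that is, I is the preimage of (0 :_G z^C).  If C = 0 then
    I = I_tilde is minimally generated by three elements.

    For the WLP, take L = y + s z + w.  In the basis s^j y^i z^j w^k of G,
    multiplication by L is the multiplication by y + z + w on
    K[y,z,w]/(y^(gam2+1), z^(gam3+1), w^(gam4+1)) plus s^(gam3+1) times a fixed
    matrix.  The former is injective in degrees d with 2d < D by the
    representation theory of sl2, hence so is the sum for some s, and
    surjectivity in the other degrees follows by Gorenstein duality. *)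

Require Import Defs.
From HB Require Import structures.
From mathcomp Require Import all_boot all_order all_algebra.
From mathcomp Require Import ssrcomplements bigenough ring zify.

Set Implicit Arguments.
Unset Strict Implicit.
Unset Printing Implicit Defensive.

Import GRing.Theory BigEnough.
Local Open Scope ring_scope.

(** * Ideals defined by keys *)

Section KeyIdeal.
Variables (K : fieldType) (n : nat).
Implicit Types (m u : 'X_{1..n}) (p q : {mpoly K[n]}).

Section Coefficient.
(* [key m] labels the class of the monomial [m] in the quotient by [key_ideal];
   it is [None] if that class is 0. *)
Variables (T : eqType) (key : 'X_{1..n} -> option T).

Definition fibre_coef (e : T) p : K := \sum_(m <- msupp p | key m == Some e) p@_m.

(** A degree bound gives an index set independent of [p], as linearity needs. *)
Lemma fibre_coefwE e k p : (msize p <= k)%N ->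
  fibre_coef e p = \sum_(m : 'X_{1..n < k} | key m == Some e) p@_m.
Proof.
move=> lt_pk; pose I : subFinType _ := 'X_{1..n < k}.
rewrite /fibre_coef (big_mksub_cond I) //=; first last.
+ by move=> x /msize_mdeg_lt /leq_trans /(_ lt_pk) ->.
+ by rewrite msupp_uniq.
by rewrite -big_filter_cond big_rmcond ?big_filter //= => m /memN_msupp_eq0.
Qed.

Lemma fibre_coef_is_linear e : scalar (fibre_coef e).
Proof.
move=> c p q /=; pose_big_enough l.
  rewrite (fibre_coefwE _ (k := l)) // (fibre_coefwE _ (k := l) (p := p)) //.
  rewrite (fibre_coefwE _ (k := l) (p := q)) //.
  rewrite mulr_sumr -big_split /=; apply: eq_bigr => m _.
  by rewrite linearP.
by close.
Qed.

HB.instance Definition _ e :=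
  GRing.isLinear.Build K {mpoly K[n]} K _ (fibre_coef e) (fibre_coef_is_linear e).

Lemma fibre_coefX e m : fibre_coef e 'X_[m] = (key m == Some e)%:R.
Proof.
by rewrite /fibre_coef msuppX big_mkcond big_seq1 mcoeffX eqxx; case: ifP.
Qed.

Definition key_ideal p := forall e, fibre_coef e p = 0.

Lemma key_idealX m : key_ideal 'X_[m] <-> key m = None.
Proof.
split=> [h | h e]; last by rewrite fibre_coefX h.
case E: (key m) => [e|//]; have := h e; rewrite fibre_coefX E eqxx => /eqP.
by rewrite oner_eq0.
Qed.

Lemma key_idealB m m' : key m = key m' -> key_ideal ('X_[m] - 'X_[m']).
Proof. by move=> h e; rewrite linearB /= !fibre_coefX h subrr. Qed.

(* A polynomial of the key ideal is rewritten, fibre by fibre, modulo [J]. *)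
Lemma key_ideal_sub (J : {mpoly K[n]} -> Prop) :
  J 0 -> (forall p q, J p -> J q -> J (p + q)) -> (forall c p, J p -> J (c *: p)) ->
  (forall m, key m = None -> J 'X_[m]) ->
  (forall m m', key m = key m' -> key m != None -> J ('X_[m] - 'X_[m'])) ->
  forall p, key_ideal p -> J p.
Proof.
move=> J0 JD JZ JN JE p pI.
have Jsum (U : eqType) (r : seq U) (P : pred U) F :
    (forall i, i \in r -> P i -> J (F i)) -> J (\sum_(i <- r | P i) F i).
  move=> h; rewrite big_seq_cond; apply: big_ind => //.
  by move=> i /andP[]; apply: h.
rewrite (mpolyE p) (bigID (fun m => key m == None)) /=; apply: (JD).
  by apply: (Jsum) => m _ /eqP /JN; apply: JZ.
pose fs := undup (pmap key (msupp p)).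
have memfs m e : m \in msupp p -> key m = Some e -> e \in fs.
  by move=> ms km; rewrite mem_undup mem_pmap; apply/mapP; exists m.
have -> : \sum_(m <- msupp p | key m != None) p@_m *: 'X_[m] =
    \sum_(e <- fs) \sum_(m <- msupp p | key m == Some e) p@_m *: 'X_[m].
  rewrite (exchange_big_dep (fun m => key m != None)) /=; last first.
    by move=> e m _ /eqP ->.
  rewrite big_seq_cond [RHS]big_seq_cond; apply: eq_bigr => m /andP[ms].
  case km: (key m) => [e|//] _.
  rewrite (big_rem e) /= ?(memfs m) // eqxx big_seq_cond big1 ?addr0 // => e'.
  rewrite mem_rem_uniq ?undup_uniq // inE -andbA => /and3P[+ _ /eqP[]].
  by move=> /eqP h1 h2; case: h1.
apply: (Jsum) => e; rewrite mem_undup mem_pmap => /mapP[m0 m0s km0] _.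
(* Each monomial of the fibre is compared with the representative [m0]; what is left is the fibre
   sum times the monomial [m0]. *)
have -> : \sum_(m <- msupp p | key m == Some e) p@_m *: 'X_[m] =
  \sum_(m <- msupp p | key m == Some e) p@_m *: ('X_[m] - 'X_[m0])
    + fibre_coef e p *: 'X_[m0].
  by rewrite /fibre_coef scaler_suml -big_split /=; apply: eq_bigr => m _; rewrite -scalerDr subrK.
rewrite pI scale0r addr0; apply: (Jsum) => m _ /eqP km; by apply/JZ/JE; rewrite km.
Qed.

Lemma fibre_coef_mulX e u p :
  fibre_coef e ('X_[u] * p) = \sum_(m <- msupp p | key (u + m) == Some e) p@_m.
Proof.
rewrite [in LHS](mpolyE p) mulr_sumr linear_sum /= [RHS]big_mkcond.
apply: eq_bigr => m _; rewrite -scalerAr -mpolyXD linearZ /= fibre_coefX.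
by case: eqP; rewrite ?mulr1 ?mulr0.
Qed.

End Coefficient.

Lemma colon_key_ideal (T : eqType) (key : _ -> option T) u :
  ideal_eq (colon (key_ideal key) 'X_[u]) (key_ideal (fun m => key (u + m)%MM)).
Proof. by move=> p; split=> h e; move: (h e); rewrite fibre_coef_mulX. Qed.

(** Only the partition into fibres matters, not the labels; a label that no monomial of the support
    carries gives an empty sum. *)
Lemma eq_key_ideal (T T' : eqType) (key : _ -> option T) (key' : _ -> option T') :
  (forall m, (key m == None) = (key' m == None)) ->
  (forall m m', key m != None -> (key m == key m') = (key' m == key' m')) ->
  ideal_eq (key_ideal key) (key_ideal key').
Proof.
move=> hN hE.
have aux e e' m p : key m = Some e -> key' m = Some e' ->
    fibre_coef key e p = fibre_coef key' e' p.
  by move=> k k'; apply: eq_bigl => m'; rewrite -k -k' eq_sym hE ?k.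
have empty (U : eqType) (f : _ -> option U) e p :
    (forall m, m \in msupp p -> f m != Some e) -> fibre_coef f e p = 0.
  move=> h; rewrite /fibre_coef big_seq_cond big1 // => m /andP[/h].
  by move=> /negP.
move=> p; split=> pI e.
  have [/hasP[m _ /eqP k'] | /hasPn h] := boolP (has (fun m => key' m == Some e) (msupp p)).
    case k: (key m) (hN m) => [e'|]; rewrite k' // => _.
    by rewrite -(aux _ _ _ _ k k').
  exact: empty.
have [/hasP[m _ /eqP k] | /hasPn h] := boolP (has (fun m => key m == Some e) (msupp p)).
  case k': (key' m) (hN m) => [e'|]; rewrite k // => _.
  by rewrite (aux _ _ _ _ k k').
exact: empty.
Qed.

End KeyIdeal.

(** * Generalities on ideals given as predicates *)

Section IdealEq.
Variable T : comNzRingType.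
Implicit Types I J : T -> Prop.

Lemma ideal_eq_trans I J L : ideal_eq I J -> ideal_eq J L -> ideal_eq I L.
Proof. by move=> h1 h2 p; rewrite h1. Qed.

Lemma ideal_eq_sym I J : ideal_eq I J -> ideal_eq J I.
Proof. by move=> h p; rewrite h. Qed.

Lemma is_ideal_sum I (U : eqType) (r : seq U) (F : U -> T) : is_ideal I ->
  (forall i, i \in r -> I (F i)) -> I (\sum_(i <- r) F i).
Proof.
by case=> I0 ID _ h; rewrite big_seq; apply: big_ind.
Qed.

Lemma ideal_of_is_ideal (gs : seq T) : is_ideal (ideal_of gs).
Proof.
split=> [|p q [s [hs ->]] [s' [hs' ->]]|a p [s [hs ->]]].
- by exists [::]; rewrite big_nil.
- exists (s ++ s'); rewrite big_cat; split=> // u.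
  by rewrite mem_cat => /orP[/hs|/hs'].
- exists [seq (a * u.1, u.2) | u <- s]; split.
    by move=> _ /mapP[u /hs[_ ?] ->].
  by rewrite big_map mulr_sumr; apply: eq_bigr => u _; rewrite mulrA.
Qed.

Lemma mem_ideal_of (gs : seq T) x : x \in gs -> ideal_of gs x.
Proof.
move=> xs; exists [:: (1, x)]; split=> [u|]; last by rewrite big_seq1 mul1r.
by rewrite inE => /eqP ->.
Qed.

Lemma ideal_of_sub (gs : seq T) I : is_ideal I ->
  (forall x, x \in gs -> I x) -> forall p, ideal_of gs p -> I p.
Proof.
move=> Ii h p [s [hs ->]]; apply: is_ideal_sum => // u /hs[_ /h].
by case: Ii => _ _; apply.
Qed.

Lemma ideal_add_is_ideal I J : is_ideal I -> is_ideal J -> is_ideal (ideal_add I J).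
Proof.
move=> [I0 ID IM] [J0 JD JM]; split.
- by exists 0, 0; rewrite addr0.
- move=> _ _ [a [b [Ia Jb ->]]] [c [d [Ic Jd ->]]].
  by exists (a + c), (b + d); rewrite addrACA; split; auto.
- by move=> c _ [a [b [Ia Jb ->]]]; exists (c * a), (c * b); rewrite mulrDr; split; auto.
Qed.

Lemma ideal_addl I J p : is_ideal J -> I p -> ideal_add I J p.
Proof. by case=> J0 _ _ Ip; exists p, 0; rewrite addr0. Qed.

Lemma ideal_addr I J p : is_ideal I -> J p -> ideal_add I J p.
Proof. by case=> I0 _ _ Jp; exists 0, p; rewrite add0r. Qed.

Lemma ideal_add_sub I J L : is_ideal L -> (forall p, I p -> L p) ->
  (forall p, J p -> L p) -> forall p, ideal_add I J p -> L p.
Proof. by case=> _ LD _ hI hJ _ [a [b [/hI La /hJ Lb ->]]]; apply: LD. Qed.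

End IdealEq.

Lemma is_idealZ (K : fieldType) n (J : {mpoly K[n]} -> Prop) :
  is_ideal J -> forall c p, J p -> J (c *: p).
Proof. by case=> _ _ JM c p; rewrite -mul_mpolyC; apply: JM. Qed.

(* The classes of the monomials of such an algebra, together with 0, form a
   finite cancellative monoid in which every nonzero element divides the class
   of [t]: this is what makes the algebra Gorenstein. *)
Record gorenstein_key n (T : eqType) (key : 'X_{1..n} -> option T)
    (t : 'X_{1..n}) : Prop := GorensteinKey {
  gk_absorb : forall u m, key m = None -> key (u + m)%MM = None;
  gk_cong : forall u m m', key m = key m' -> key (u + m)%MM = key (u + m')%MM;
  gk_cancel : forall u m m', key (u + m)%MM = key (u + m')%MM ->
    key (u + m)%MM != None -> key m = key m';
  gk_deg : forall m m', key m = key m' -> key m != None -> mdeg m = mdeg m';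
  gk_top : key t != None;
  gk_divides : forall m, key m != None -> exists u, key (u + m)%MM = key t }.

(** * Algebras defined by Gorenstein keys *)

Section GorensteinKey.
Variables (K : fieldType) (n : nat) (T : eqType) (key : 'X_{1..n} -> option T).
Variables (t : 'X_{1..n}).
Hypothesis gk : gorenstein_key key t.
Let J : {mpoly K[n]} -> Prop := key_ideal key.

(** By congruence and cancellation, the monomials that [u] sends into a given fibre form one whole
    fibre or none, so every fibre sum of the product by [u] is a fibre sum of [p] or 0. *)
Lemma key_ideal_is_ideal : is_ideal J.
Proof.
have JX u p : J p -> J ('X_[u] * p).
  move=> pI e; rewrite fibre_coef_mulX.
  have [/hasP[m0 m0s /eqP k0] | /hasPn h] :=
    boolP (has (fun m => key (u + m) == Some e) (msupp p)); last first.
    by rewrite big_seq_cond big1 // => m /andP[/h/negP].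
  case km: (key m0) => [e0|]; last by rewrite (gk_absorb gk) in k0.
  rewrite -[RHS](pI e0) /fibre_coef; apply: eq_bigl => m; rewrite -k0 -km.
  apply/eqP/eqP => [h|h]; last exact: (gk_cong gk).
  by apply: (gk_cancel gk) (h) _; rewrite h k0.
split=> [e|p q pI qI e|a p pI].
- by rewrite linear0.
- by rewrite linearD /= pI qI addr0.
rewrite (mpolyE a) mulr_suml => e; rewrite linear_sum /= big1 // => m _.
by rewrite -scalerAl linearZ /= (JX _ _ pI) mulr0.
Qed.

(** A fibre with a label lies in one degree, so taking a homogeneous component keeps its whole sum
    or removes it. *)
Lemma key_homogeneous : homogeneous_ideal J.
Proof.
split=> [|p d pI e]; first exact: key_ideal_is_ideal.
rewrite pihomogE linear_sum /=.
have [/hasP[m0 m0s /eqP k0] | /hasPn h] :=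
    boolP (has (fun m => key m == Some e) (msupp p)); last first.
  rewrite big_seq_cond big1 // => m /andP[/h /negPf hm _].
  by rewrite linearZ /= fibre_coefX hm mulr0.
have E m : p@_m * (key m == Some e)%:R = if key m == Some e then p@_m else 0.
  by case: ifP; rewrite ?mulr1 ?mulr0.
under eq_bigr => m _ do rewrite linearZ /= fibre_coefX E.
rewrite -big_mkcondr /=.
have [dm|dm] := eqVneq (mdeg m0) d.
  rewrite -[RHS](pI e) /fibre_coef; apply: eq_bigl => m.
  case: (key m =P Some e) => [km|]; rewrite ?andbF // andbT -dm.
  by apply/eqP; apply: (gk_deg gk); rewrite km ?k0.
rewrite big1 // => m /andP[/eqP dm' /eqP km].
by case/eqP: dm; rewrite -dm'; apply: (gk_deg gk); rewrite ?km ?k0.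
Qed.

Lemma key_mdeg_le m : key m != None -> (mdeg m <= mdeg t)%N.
Proof.
move=> /(gk_divides gk)[u h]; rewrite -(gk_deg gk h) ?mdegD ?leq_addl //.
by rewrite h (gk_top gk).
Qed.

Lemma key_socle_degree : socle_degree J (mdeg t).
Proof.
split=> [|e p le_te /dhomogP hp].
  exists 'X_[t]; split; first by rewrite dhomogX.
  by move/key_idealX => h; have := gk_top gk; rewrite h.
rewrite (mpolyE p); apply: is_ideal_sum; first exact: key_ideal_is_ideal.
move=> m /hp dm; rewrite -mul_mpolyC; case: key_ideal_is_ideal => _ _; apply.
apply/key_idealX/eqP; apply: contraLR le_te => /key_mdeg_le.
by rewrite -leqNgt -dm.
Qed.

(** Monomials of degree above [mdeg t] vanish in the quotient, so the finitely many others span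
    it. *)
Lemma key_artinian : artinian J.
Proof.
pose r := [seq (bmnm m : 'X_{1..n}) | m <- enum {: 'X_{1..n < (mdeg t).+1}}].
exists (map (fun m => 'X_[m]) r) => p; exists (fun i => p@_(nth 0%MM r i)).
rewrite -(big_mkord xpredT (fun i => p@_(nth 0%MM r i) *: (map _ r)`_i)) size_map.
have -> : \sum_(0 <= i < size r) p@_(nth 0%MM r i) *: (map (fun m => 'X_[m]) r)`_i
    = \sum_(m <- r) p@_m *: 'X_[m].
  rewrite [RHS](big_nth 0%MM).
  by apply: eq_big_nat => i /andP[_ lt_ir]; rewrite (nth_map 0%MM).
have -> : p - \sum_(m <- r) p@_m *: 'X_[m] =
    \sum_(m <- msupp p | (mdeg t < mdeg m)%N) p@_m *: 'X_[m].
  rewrite {1}(mpolyE p) (bigID (fun m => mdeg t < mdeg m)%N) /= -addrA.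
  rewrite -[RHS]addr0; congr (_ + _); apply/eqP; rewrite subr_eq0; apply/eqP.
  have ur : uniq r by rewrite map_inj_uniq ?enum_uniq //; apply: val_inj.
  have mr m : (m \in r) = (mdeg m <= mdeg t)%N.
    apply/mapP/idP => [[b _ ->]|h]; first by rewrite -ltnS bmdeg.
    by exists (@BMultinom n (mdeg t).+1 m h); rewrite ?mem_enum.
  rewrite [RHS](bigID (mem (msupp p))) /= [X in _ + X]big1 ?addr0; last first.
    by move=> m /memN_msupp_eq0 ->; rewrite scale0r.
  rewrite -[LHS]big_filter -[RHS]big_filter; apply: perm_big; apply: uniq_perm.
  + by rewrite filter_uniq ?msupp_uniq.
  + by rewrite filter_uniq.
  by move=> m; rewrite !mem_filter mr -leqNgt andbC.
rewrite -big_filter; apply: is_ideal_sum; first exact: key_ideal_is_ideal.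
move=> m; rewrite mem_filter => /andP[h _].
rewrite -mul_mpolyC; case: key_ideal_is_ideal => _ _; apply.
by apply/key_idealX/eqP; apply: contraLR h => /key_mdeg_le; rewrite -leqNgt.
Qed.

(** The class of [t] spans the socle. For any other label [e] of a monomial, some [u] other than 1
    moves the fibre of [e] to that of [t]; since [u] kills a socle element, its fibre sum at [e] is
    0. *)
Lemma key_gorenstein : gorenstein_artinian J.
Proof.
split; [split; first exact: key_homogeneous| exact: key_artinian |].
  rewrite -mpolyX0 => /key_idealX k0.
  by have := gk_top gk; rewrite -[t]addm0 (gk_absorb gk).
exists 'X_[t]; split=> [i| |p ps].
- rewrite -mpolyXD; apply/key_idealX/eqP/negP => /negP /key_mdeg_le.
  by rewrite mdegD mdeg1 add1n ltnn.
- by move/key_idealX => h; have := gk_top gk; rewrite h.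
case kt: (key t) (gk_top gk) => [et|//] _.
exists (fibre_coef key et p) => e; rewrite linearB linearZ /= fibre_coefX kt.
have [<-|ne] := eqVneq et e; first by rewrite eqxx mulr1 subrr.
have -> : (Some et == Some e) = false by apply: contra_neqF ne => /eqP[].
rewrite mulr0 subr0.
have [/hasP[m0 m0s /eqP k0] | /hasPn h] :=
    boolP (has (fun m => key m == Some e) (msupp p)); last first.
  by rewrite /fibre_coef big_seq_cond big1 // => m /andP[/h/negP].
have [|u hu] := gk_divides gk (m := m0); first by rewrite k0.
have u0 : u != 0%MM.
  by apply: contra_neq ne => u0; move: hu; rewrite u0 add0m k0 kt => -[].
have [i ui] : exists i, u i != 0%N.
  by apply/existsP; apply: contra_neqT u0; rewrite negb_exists => /forallP h;
    apply/mnmP => i; rewrite mnm0E; apply/eqP; move: (h i); rewrite negbK.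
have eu : u = (u - U_(i) + U_(i))%MM.
  rewrite submK //; apply/mnm_lepP => j; rewrite mnm1E.
  by case: eqP => // <-; rewrite lt0n.
have Ju : J ('X_[u] * p).
  rewrite eu mpolyXD -mulrA; case: key_ideal_is_ideal => _ _; apply.
  exact: ps.
rewrite -[RHS](Ju et) fibre_coef_mulX /fibre_coef; apply: eq_bigl => m.
rewrite -kt -hu -k0; apply/eqP/eqP => [h|h]; first exact: (gk_cong gk).
by apply: (gk_cancel gk) (h) _; rewrite h hu kt.
Qed.

End GorensteinKey.

(** * Normal forms in G *)

(* Locked, because [mnmDE] would otherwise match through the definition. *)
HB.lock Definition mon (i j k : nat) : 'X_{1..3} :=
  (U_(inord 0) *+ i + U_(inord 1) *+ j + U_(inord 2) *+ k)%MM.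

Section ThreeVariables.

Lemma monE i j k :
  ((mon i j k (inord 0) = i) * (mon i j k (inord 1) = j) *
   (mon i j k (inord 2) = k))%type.
Proof.
have ne u v : (u < 3)%N -> (v < 3)%N -> (inord u == inord v :> 'I_3) = (u == v).
  by move=> hu hv; rewrite -val_eqE /= !inordK.
by rewrite mon.unlock !mnmDE !mulmnE !mnm1E !ne //= !mul1n !mul0n ?addn0.
Qed.

Lemma ord3_ind (P : 'I_3 -> Prop) :
  P (inord 0) -> P (inord 1) -> P (inord 2) -> forall i, P i.
Proof.
move=> h0 h1 h2 [[|[|[|//]]] h].
- by rewrite (_ : Ordinal h = inord 0) //; apply: val_inj; rewrite /= inordK.
- by rewrite (_ : Ordinal h = inord 1) //; apply: val_inj; rewrite /= inordK.
- by rewrite (_ : Ordinal h = inord 2) //; apply: val_inj; rewrite /= inordK.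
Qed.

Lemma mon_eta (m : 'X_{1..3}) : m = mon (m (inord 0)) (m (inord 1)) (m (inord 2)).
Proof. by apply/mnmP; apply: ord3_ind; rewrite monE. Qed.

Lemma monD i j k i' j' k' :
  (mon i j k + mon i' j' k' = mon (i + i') (j + j') (k + k'))%MM.
Proof. by rewrite [LHS]mon_eta; congr mon; rewrite mnmDE !monE. Qed.

Lemma mdeg_mon i j k : mdeg (mon i j k) = (i + j + k)%N.
Proof. by rewrite mon.unlock !mdegD !mdegMn !mdeg1 !mul1n. Qed.

Lemma mpolyX_mon (R : nzRingType) i j k :
  'X_[mon i j k] = 'X_(inord 0) ^+ i * 'X_(inord 1) ^+ j * 'X_(inord 2) ^+ k
    :> {mpoly R[3]}.
Proof. by rewrite mon.unlock !mpolyXD !mpolyXn. Qed.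

End ThreeVariables.

Section NormalForm.
Variables gam2 gam3 gam4 mu nu : nat.

(* The label of the class of [m] modulo [I_tilde]: the exponents of its normal form
   for z^(gam3+1) -> y^mu w^nu, or [None] if [m] vanishes. *)
Definition nf (m : 'X_{1..3}) : option (nat * nat * nat) :=
  let q := (m (inord 1) %/ gam3.+1)%N in
  let i := (m (inord 0) + q * mu)%N in
  let k := (m (inord 2) + q * nu)%N in
  if (i <= gam2)%N && (k <= gam4)%N then Some (i, m (inord 1) %% gam3.+1, k)%N
  else None.

Lemma nf_absorb u m : nf m = None -> nf (u + m)%MM = None.
Proof.
rewrite /nf !mnmDE; case: ifP => // h _; case: ifP => // h'.
have := leq_div2r gam3.+1 (leq_addl (u (inord 1)) (m (inord 1))).
by move: h h'; set q := (_ %/ _)%N; set q' := (_ %/ _)%N; nia.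
Qed.

Lemma nf_box i j k : (i <= gam2)%N -> (j <= gam3)%N -> (k <= gam4)%N ->
  nf (mon i j k) = Some (i, j, k).
Proof.
move=> hi hj hk; rewrite /nf !monE divn_small ?ltnS // modn_small ?ltnS //.
by rewrite !mul0n !addn0 hi hk.
Qed.

Lemma nf_some m i j k : nf m = Some (i, j, k) ->
  [/\ (i <= gam2)%N, (j <= gam3)%N & (k <= gam4)%N].
Proof.
by rewrite /nf; case: ifP => // /andP[? ?] [<- <- <-]; split=> //; rewrite -ltnS ltn_pmod.
Qed.

Lemma nf_reduce u m i j k : nf m = Some (i, j, k) ->
  nf (u + m)%MM = nf (u + mon i j k)%MM.
Proof.
rewrite {1}/nf; case: ifP => // _ [<- <- <-]; rewrite /nf !mnmDE !monE.
set b := gam3.+1; set u1 := u (inord 1); set m1 := m (inord 1).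
have -> : ((u1 + m1) %/ b = (m1 %/ b) + (u1 + m1 %% b) %/ b)%N.
  by rewrite {1}(divn_eq m1 b) addnCA divnMDl.
by rewrite modnDmr !mulnDl !addnA; do 2!rewrite addnAC.
Qed.

(** Equal remainders after adding [u] make the two [z]-exponents congruent, and their quotients then
    differ by the difference of [q] and [q']; this is what the [y]- and [w]-exponents need in order
    to agree. *)
Lemma nf_cancel u m m' : nf (u + m)%MM = nf (u + m')%MM ->
  nf (u + m)%MM != None -> nf m = nf m'.
Proof.
move=> h ne0.
have nm : nf m != None by apply: contra_neq ne0 => /nf_absorb ->.
have nm' : nf m' != None by apply: contra_neq ne0 => /nf_absorb; rewrite h.
move: h ne0 nm nm'; rewrite /nf !mnmDE.
case: ifP => // _; case: ifP => // _ [] + + + _.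
case: ifP => // _; case: ifP => // _ + + + _ _.
set b := gam3.+1; set u1 := u (inord 1); set m1 := m (inord 1); set m1' := m' (inord 1).
set q := ((u1 + m1) %/ b)%N; set q' := ((u1 + m1') %/ b)%N => h0 h1 h2.
have e : (m1 + q' * b = m1' + q * b)%N.
  have := divn_eq (u1 + m1) b; have := divn_eq (u1 + m1') b.
  by rewrite -/q -/q' h1; lia.
have er : (m1 %% b = m1' %% b)%N.
  by rewrite -(modnMDl q' m1) addnC e addnC modnMDl.
have eq : (m1 %/ b + q' = m1' %/ b + q)%N.
  by have := congr1 (divn^~ b) e; rewrite addnC (addnC m1') /= !divnMDl //; lia.
have e0 := congr1 (muln^~ mu) eq; have e2 := congr1 (muln^~ nu) eq.
move: e0 e2; rewrite /= !mulnDl => e0 e2.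
by rewrite er; congr (Some (_, _, _)); lia.
Qed.

Hypothesis mu_nu : (mu + nu = gam3.+1)%N.

(** The rewriting rule is homogeneous by [mu_nu]. *)
Lemma nf_deg m i j k : nf m = Some (i, j, k) -> mdeg m = (i + j + k)%N.
Proof.
rewrite /nf; case: ifP => // _ [<- <- <-].
rewrite {1}[m]mon_eta mdeg_mon {1}(divn_eq (m (inord 1)) gam3.+1) -mu_nu mulnDr.
by lia.
Qed.

Lemma nf_gorenstein : gorenstein_key nf (mon gam2 gam3 gam4).
Proof.
split=> [||u m m'|m m'||m].
- exact: nf_absorb.
- move=> u m m' h; case km': (nf m) => [[[i j] k]|]; last first.
    by rewrite !nf_absorb // -h.
  by rewrite (nf_reduce u km') (@nf_reduce u m' i j k) // -h.
- exact: nf_cancel.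
- case km: (nf m) => [[[i j] k]|//] km' _.
  by rewrite (nf_deg km) (nf_deg (esym km')).
- by rewrite nf_box.
case km: (nf m) => [[[i j] k]|//] _.
exists (mon (gam2 - i) (gam3 - j) (gam4 - k)).
have [hi hj hk] := nf_some km.
by rewrite (nf_reduce _ km) monD !subnK.
Qed.

Variable K : fieldType.

(** By [red], every monomial is congruent to its reduced form modulo [I_tilde]; if that form leaves
    the box, it is a multiple of the first or the last generator. *)
Lemma I_tilde_key : ideal_eq (I_tilde K gam2 gam3 gam4 mu nu) (key_ideal nf).
Proof.
have Xy i : (vy : {mpoly K[3]}) ^+ i = 'X_[mon i 0 0].
  by rewrite mpolyX_mon !expr0 !mulr1.
have Xz i : (vz : {mpoly K[3]}) ^+ i = 'X_[mon 0 i 0].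
  by rewrite mpolyX_mon !expr0 mulr1 mul1r.
have Xw i : (vw : {mpoly K[3]}) ^+ i = 'X_[mon 0 0 i].
  by rewrite mpolyX_mon !expr0 !mul1r.
move=> p; split.
  apply: ideal_of_sub; first exact: key_ideal_is_ideal nf_gorenstein.
  move=> x; rewrite !inE => /or3P[] /eqP ->.
  - by rewrite Xy; apply/key_idealX; rewrite /nf !monE ltnNge leq_addr.
  - rewrite Xy Xz Xw -mpolyXD monD; apply: key_idealB.
    by rewrite /nf !monE divnn modnn div0n mod0n !mul0n !addn0 !mul1n !add0n.
  - by rewrite Xw; apply/key_idealX; rewrite /nf !monE [(gam4.+1 + _ <= _)%N]leqNgt leq_addr andbF.
have [It0 ItD ItM] := ideal_of_is_ideal
  [:: (vy : {mpoly K[3]}) ^+ gam2.+1; vz ^+ gam3.+1 - vy ^+ mu * vw ^+ nu; vw ^+ gam4.+1].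
have red (m : 'X_{1..3}) : let q := (m (inord 1) %/ gam3.+1)%N in
  I_tilde K gam2 gam3 gam4 mu nu ('X_[m] -
    'X_[mon (m (inord 0) + q * mu) (m (inord 1) %% gam3.+1) (m (inord 2) + q * nu)]).
  move=> q; have {1}-> : m = (mon (m (inord 0)) (m (inord 1) %% gam3.+1) (m (inord 2))
      + mon 0 (q * gam3.+1) 0)%MM.
    by rewrite monD !addn0 addnC -divn_eq -mon_eta.
  rewrite -[X in _ - 'X_[mon _ X _]]addn0 -monD !mpolyXD -mulrBr; apply: (ItM).
  (* One more use of the rule: the difference is a combination of the previous difference and of the
     binomial generator. *)
  elim: (q) => [|n IHn]; first by rewrite !mul0n subrr.
  have -> : 'X_[mon 0 (n.+1 * gam3.+1) 0] - 'X_[mon (n.+1 * mu) 0 (n.+1 * nu)] =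
    'X_[mon 0 gam3.+1 0] * ('X_[mon 0 (n * gam3.+1) 0] - 'X_[mon (n * mu) 0 (n * nu)])
    + 'X_[mon (n * mu) 0 (n * nu)] * ('X_[mon 0 gam3.+1 0] - 'X_[mon mu 0 nu])
    :> {mpoly K[3]}.
    rewrite !mulrBr -!mpolyXD !monD !addn0 !add0n !mulSn [(gam3.+1 + n * _)%N]addnC.
    by rewrite addrA [in RHS]addnC subrK ![(_ + n * _)%N]addnC.
  apply: (ItD); apply: (ItM) => //; apply: mem_ideal_of.
  by rewrite !inE !Xz !Xy !Xw -mpolyXD monD !addn0 !add0n eqxx orbT.
apply: key_ideal_sub => [||c q|m|m m']; [by [] | exact: ItD | exact: (is_idealZ (ideal_of_is_ideal _)) | |].
  move=> h; rewrite -[X in I_tilde _ _ _ _ _ _ X](subrK ('X_[mon (m (inord 0) + m (inord 1) %/ gam3.+1 * mu)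
    (m (inord 1) %% gam3.+1) (m (inord 2) + m (inord 1) %/ gam3.+1 * nu)])).
  apply: (ItD); first exact: red.
  move: h; rewrite /nf; case: ifP => // /negbT; rewrite negb_and -!ltnNge => /orP[] h _.
    rewrite -(subnK h) -[X in mon _ X]addn0 -[X in mon _ _ X]addn0 -monD mpolyXD; apply: (ItM).
    by apply: mem_ideal_of; rewrite -Xy !inE eqxx.
  rewrite -(subnK h) -[X in mon X]addn0 -[X in mon _ X]addn0 -monD mpolyXD; apply: (ItM).
  by apply: mem_ideal_of; rewrite -Xw !inE eqxx !orbT.
have {}red m0 i j k : nf m0 = Some (i, j, k) ->
    I_tilde K gam2 gam3 gam4 mu nu ('X_[m0] - 'X_[mon i j k]).
  by rewrite /nf; case: ifP => // _ [<- <- <-]; apply: red.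
case km: (nf m) => [[[i j] k]|//] /esym km' _.
have := ItD _ _ (red _ _ _ _ km) (ItM (-1) _ (red _ _ _ _ km')).
by rewrite mulN1r opprB addrA subrK.
Qed.

End NormalForm.

(** * Perturbation of an injective matrix *)

Section Pencil.
Variable K : fieldType.
Hypothesis K0 : [pchar K] =i pred0.

Let char0 n : (n%:R == 0 :> K) = (n == 0%N).
Proof. by move/pcharf0P: K0 => ->. Qed.

Lemma natr_inj : injective (fun n : nat => n%:R : K).
Proof.
have aux n m : (n <= m)%N -> n%:R = m%:R :> K -> n = m.
  move=> le_nm /eqP; rewrite eq_sym -subr_eq0 -natrB // char0 subn_eq0 => le_mn.
  by apply/eqP; rewrite eqn_leq le_nm.
move=> n m h; case: (leqP n m) => [|/ltnW] le; first exact: aux.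
by apply/esym/aux.
Qed.

Lemma natr_neq0 n : (n != 0)%N -> n%:R != 0 :> K.
Proof. by rewrite char0. Qed.

Lemma nonroot_ex (f : nat -> K) (p : {poly K}) :
  injective f -> p != 0 -> exists n, ~~ root p (f n).
Proof.
move=> f_inj p0; have /allPn[_ /mapP[n _ ->] h] :
  ~~ all (root p) [seq f n | n <- iota 0 (size p)].
  apply/negP => h; have := max_poly_roots p0 h.
  by rewrite map_inj_uniq ?iota_uniq // size_map size_iota ltnn => /(_ isT).
by exists n.
Qed.

(* If [P *m M0] has the same left kernel as [P], then [P *m M0 *m Q = P] for
   some [Q], so [M0 + t N] can fail to be injective on the image of the
   projection [P] only when [- t^-1] is an eigenvalue of [N *m Q]. *)
Lemma pencil_injective n (P M0 N : 'M[K]_n) (b : nat) : (0 < b)%N ->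
  (forall u : 'rV_n, u *m P *m M0 = 0 -> u *m P = 0) ->
  exists2 s : nat, (0 < s)%N & forall u : 'rV_n, u *m P = u ->
    u *m (M0 + s%:R ^+ b *: N) = 0 -> u = 0.
Proof.
move=> b_gt0 inj.
have [Q hQ] : exists Q, P *m M0 *m Q = P.
  (* Through transposes this is an inclusion of column spaces; it follows from the hypothesis on
     left kernels, applied to the rows of [k^T]. *)
  have sub : (P^T <= (P *m M0)^T)%MS.
    rewrite submxE; set k := cokermx _.
    have hk : k^T *m (P *m M0) = 0.
      by apply: trmx_inj; rewrite trmx_mul trmxK trmx0 mulmx_coker.
    apply/eqP; apply: trmx_inj; rewrite trmx_mul trmxK trmx0.
    apply/row_matrixP => i; rewrite row0 row_mul; apply: inj.
    by rewrite -mulmxA -row_mul hk row0.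
  exists (P^T *m pinvmx (P *m M0)^T)^T; apply: trmx_inj.
  by rewrite trmx_mul trmxK mulmxKpV.
(* The values of [- t^-1] for [t = (s+1)^b]. They are pairwise distinct as [b] is positive and the
   characteristic is 0, so one of them is not an eigenvalue. *)
pose f s : K := - (s.+1%:R ^+ b)^-1.
have f_inj : injective f.
  move=> x y /oppr_inj/invr_inj; rewrite -!natrX => /natr_inj /eqP.
  by rewrite eqn_exp2r // => /eqP[].
have [s hs] := nonroot_ex f_inj (monic_neq0 (char_poly_monic (N *m Q))).
exists s.+1 => // u uP hu; apply/eqP; apply: contraNT hs => u0.
rewrite -eigenvalue_root_char; apply/eigenvalueP; exists u => //.
have := congr1 (mulmx^~ Q) hu; rewrite /= mul0mx mulmxDr mulmxDl -{1}uP.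
rewrite -(mulmxA u P) -(mulmxA u) hQ uP -scalemxAr -scalemxAl => /eqP.
rewrite addrC addr_eq0 mulmxA => /eqP h.
have s0 : s.+1%:R ^+ b != 0 :> K by rewrite expf_neq0 // natr_neq0.
by rewrite /f scaleNr -scalerN -h scalerA mulVf // scale1r.
Qed.

Variable B : finType.

(** Functions on [B] are row vectors, so [M e' e] is the coefficient of [e] in the image of [e']. *)
Let row_of (f : B -> K) : 'rV[K]_#|B| := \row_i f (enum_val i).
Let mx_of (M : B -> B -> K) : 'M[K]_#|B| := \matrix_(i, j) M (enum_val i) (enum_val j).

Let sum_enum (F : B -> K) : \sum_(i < #|B|) F (enum_val i) = \sum_e F e.
Proof. by rewrite -(big_enum_val F); apply: eq_bigl. Qed.

Let row_mulE (f : B -> K) M :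
  row_of f *m mx_of M = row_of (fun e => \sum_e' f e' * M e' e).
Proof.
apply/rowP => j; rewrite !mxE -sum_enum; apply: eq_bigr => i _.
by rewrite !mxE.
Qed.

Let row_eq0 (f : B -> K) : row_of f = 0 -> forall e, f e = 0.
Proof. by move=> /rowP h e; have := h (enum_rank e); rewrite !mxE enum_rankK. Qed.

Let row0_eq (f : B -> K) : (forall e, f e = 0) -> row_of f = 0.
Proof. by move=> h; apply/rowP => i; rewrite !mxE h. Qed.

Let rowK (u : 'rV[K]_#|B|) : row_of (fun e => u 0 (enum_rank e)) = u.
Proof. by apply/rowP => i; rewrite mxE enum_valK. Qed.

Let proj (S : pred B) := mx_of (fun e e' => ((e == e') && S e)%:R).

Let row_proj (S : pred B) (f : B -> K) :
  row_of f *m proj S = row_of (fun e => f e * (S e)%:R).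
Proof.
rewrite row_mulE; apply/rowP => j; rewrite !mxE (bigD1 (enum_val j)) //= eqxx.
by rewrite big1 ?addr0 // => e /negPf ->; rewrite mulr0.
Qed.

Definition injective_on (S : pred B) (M : B -> B -> K) :=
  forall f : B -> K, (forall e, ~~ S e -> f e = 0) ->
    (forall e, \sum_e' f e' * M e' e = 0) -> forall e, f e = 0.

Lemma generic_injective_on (S : pred B) (M0 N : B -> B -> K) (b : nat) :
  (0 < b)%N -> injective_on S M0 ->
  exists2 s : nat, (0 < s)%N &
    injective_on S (fun e e' => M0 e e' + s%:R ^+ b * N e e').
Proof.
move=> b_gt0 inj; have [|s s_gt0 h] :=
    @pencil_injective _ (proj S) (mx_of M0) (mx_of N) b b_gt0.
  move=> u; rewrite -(rowK u) row_proj row_mulE => /row_eq0 u0; apply: row0_eq.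
  by apply: inj => // e /negPf ->; rewrite mulr0.
exists s => // f fS fM; apply: row_eq0; apply: h.
  rewrite row_proj; apply/rowP => i; rewrite !mxE.
  by have [_|/fS ->] := boolP (S _); rewrite ?mulr1 ?mulr0.
rewrite mulmxDr -scalemxAr !row_mulE; apply/rowP => j; rewrite !mxE.
rewrite -[RHS](fM (enum_val j)) mulr_sumr -big_split; apply: eq_bigr => e _ /=.
by rewrite mulrDr; congr (_ + _); rewrite mulrCA.
Qed.

(* [rho] is the duality of a Gorenstein algebra on the monomials of its basis. *)
Lemma dual_surjective (S : pred B) (M : B -> B -> K) (rho : B -> B) :
  involutive rho -> (forall e e', M (rho e) (rho e') = M e' e) ->
  injective_on (fun e => S (rho e)) M ->
  forall w : B -> K, exists f : B -> K,
    forall e, S e -> \sum_e' f e' * M e' e = w e.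
Proof.
move=> rhoK M_rho inj w.
(* Surjectivity onto the coordinates in [S] is an inclusion of row spaces. A column of the cokernel,
   projected to [S] and composed with [rho], is a function killed by [M], hence 0 by injectivity. *)
have sub : (proj S <= mx_of M *m proj S)%MS.
  rewrite submxE; apply/eqP; set k := cokermx _.
  have hk : mx_of M *m proj S *m k = 0 by rewrite mulmx_coker.
  apply/matrixP => i j; rewrite [RHS]mxE.
  pose g e := \sum_(l < #|B|) (proj S) (enum_rank e) l * k l j.
  suff g0 e : g e = 0 by rewrite mxE -[RHS](g0 (enum_val i)) /g enum_valK.
  have gS e' : ~~ S e' -> g e' = 0.
    move=> nS; rewrite /g big1 // => l _; rewrite mxE enum_rankK (negPf nS).
    by rewrite andbF mul0r.
  suff h : forall e, g (rho e) = 0 by rewrite -(rhoK e).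
  apply: inj => [e'|e']; first exact: gS.
  rewrite (reindex_inj (inv_inj rhoK)) /=.
  have := congr1 (fun A : 'M_#|B| => A (enum_rank (rho e')) j) hk.
  rewrite -mulmxA [X in _ = X]mxE => h0; rewrite -[RHS]h0 [RHS]mxE -[LHS]sum_enum.
  apply: eq_bigr => l _; rewrite rhoK -{1}(rhoK e') M_rho mulrC [in RHS]mxE enum_rankK.
  by congr (_ * _); rewrite mxE /g enum_valK.
have /submxP[D hD] : (row_of w *m proj S <= mx_of M *m proj S)%MS.
  exact: submx_trans (submxMl _ _) sub.
move: hD; rewrite mulmxA -(rowK D) row_mulE !row_proj => /rowP hD.
exists (fun e => D 0 (enum_rank e)) => e Se.
by have := hD (enum_rank e); rewrite !mxE enum_rankK Se !mulr1.
Qed.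

End Pencil.

(** * The sl2 action on a monomial complete intersection *)

Section SL2.
Variable K : fieldType.
Hypothesis K0 : [pchar K] =i pred0.
Variables gam2 gam3 gam4 : nat.
Local Notation D := (gam2 + gam3 + gam4)%N.
Implicit Types v : nat -> nat -> nat -> K.

(* Multiplication by y + z + w on coefficient functions, and the operator that
   makes it part of an sl2-triple on K[y,z,w]/(y^(gam2+1),z^(gam3+1),w^(gam4+1)),
   whose elements are the functions modulo those vanishing on the box. *)
Definition raise v i j k : K :=
  (if i is i'.+1 then v i' j k else 0) + (if j is j'.+1 then v i j' k else 0)
  + (if k is k'.+1 then v i j k' else 0).

Definition lower v i j k : K :=
  i.+1%:R * (gam2%:R - i%:R) * v i.+1 j k + j.+1%:R * (gam3%:R - j%:R) * v i j.+1 k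
  + k.+1%:R * (gam4%:R - k%:R) * v i j k.+1.

Definition eq_box v v' := forall i j k, (i <= gam2)%N -> (j <= gam3)%N ->
  (k <= gam4)%N -> v i j k = v' i j k.

(** The commutation relation of the sl2-triple: the weight in degree [d] is [D - 2d]. It holds at
    all exponents, inside the box or not. *)
Lemma lower_raise v i j k : lower (raise v) i j k =
  raise (lower v) i j k + (D%:R - 2%:R * (i + j + k)%:R) * v i j k.
Proof.
case: i => [|i]; case: j => [|j]; case: k => [|k]; rewrite /lower /raise;
  rewrite !natrD -?natr1 ?add0r ?addr0; ring.
Qed.

(** The factors [gam - i] vanish on the outer faces of the box, so values outside it do not
    enter. *)
Lemma lower_eq_box v v' : eq_box v v' -> eq_box (lower v) (lower v').
Proof.
move=> h i j k hi hj hk; rewrite /lower; congr (_ + _ + _).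
- move: hi; rewrite leq_eqVlt => /predU1P[->|hi]; last by rewrite h.
  by rewrite subrr mulr0 !mul0r.
- move: hj; rewrite leq_eqVlt => /predU1P[->|hj]; last by rewrite h.
  by rewrite subrr mulr0 !mul0r.
- move: hk; rewrite leq_eqVlt => /predU1P[->|hk]; last by rewrite h.
  by rewrite subrr mulr0 !mul0r.
Qed.

Lemma raise_eq_box v v' : eq_box v v' -> eq_box (raise v) (raise v').
Proof.
move=> h [|i] [|j] [|k] hi hj hk; rewrite /raise ?h //; exact: ltnW.
Qed.

Lemma lowerZ (x : K) v i j k :
  lower (fun i j k => x * v i j k) i j k = x * lower v i j k.
Proof. by rewrite /lower; ring. Qed.

Definition homog_box d v := forall i j k, (i <= gam2)%N -> (j <= gam3)%N ->
  (k <= gam4)%N -> (i + j + k != d)%N -> v i j k = 0.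

(** If [raise v] is 0, the commutation relation gives by induction that [raise] sends the iterate
    [u n.+1] of [lower] to [- (n+1) (D - 2d + n)] times [u n]. The iterate [u d.+1] is 0 for degree
    reasons, and since these coefficients are nonzero one descends to [v]. *)
Lemma raise_injective d v : (d.*2 < D)%N -> homog_box d v ->
  eq_box (raise v) (fun _ _ _ => 0) -> eq_box v (fun _ _ _ => 0).
Proof.
move=> ltdD hv rv.
pose u n := iter n lower v.
have hu n : forall i j k, (i <= gam2)%N -> (j <= gam3)%N ->
    (k <= gam4)%N -> (i + j + k + n != d)%N -> u n i j k = 0.
  elim: n => [|n IHn] i j k hi hj hk ne; first by apply: hv; rewrite // -(addn0 (_ + _)%N).
  rewrite /u iterS -/(u n).
  have aux g l (x : K) : (l <= g)%N -> ((l < g)%N -> x = 0) ->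
      l.+1%:R * (g%:R - l%:R) * x = 0.
    rewrite leq_eqVlt => /predU1P[->|lt_lg] x0; first by rewrite subrr mulr0 mul0r.
    by rewrite x0 ?mulr0.
  rewrite /lower !aux ?addr0 // => lt; apply: IHn => //; apply: contra_neq ne; lia.
have cu n : eq_box (raise (u n.+1))
    (fun i j k => - (n.+1 * (D - d.*2 + n))%:R * u n i j k).
  elim: n => [|n IHn] i j k hi hj hk.
    have := lower_raise v i j k; rewrite (lower_eq_box rv) // => E.
    have {}E : raise (u 1%N) i j k = - (D%:R - 2%:R * (i + j + k)%:R) * v i j k.
      rewrite mulNr; apply/eqP; rewrite -addr_eq0 /u /= -E.
      by rewrite /lower !mulr0 !addr0.
    rewrite E mul1n addn0; have [e|ne] := eqVneq (i + j + k)%N d; last by rewrite /u /= hv ?mulr0.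
    by rewrite e natrB 1?ltnW // -mul2n natrM.
  have E := lower_raise (u n.+1) i j k.
  have F := lower_eq_box IHn hi hj hk; rewrite lowerZ in F.
  rewrite /u iterS -/(u n.+1).
  have {E F} -> : raise (lower (u n.+1)) i j k =
      - ((n.+1 * (D - d.*2 + n))%:R + (D%:R - 2%:R * (i + j + k)%:R)) * u n.+1 i j k.
    by rewrite mulNr mulrDl opprD -mulNr -F E addrK.
  have [e|ne] := eqVneq (i + j + k + n.+1)%N d; last by rewrite hu ?mulr0.
  congr (- _ * _); apply/eqP; rewrite addrA subr_eq -natrM -!natrD; apply/eqP.
  congr (_%:R); set X := (D - d.*2)%N.
  have -> : D = (X + (i + j + k + n.+1).*2)%N by rewrite e subnK // ltnW.
  by rewrite -!muln2; ring.
have van n : eq_box (u n) (fun _ _ _ => 0) -> eq_box v (fun _ _ _ => 0).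
  elim: n => [//|n IHn] h; apply: IHn => i j k hi hj hk.
  have := cu n i j k hi hj hk; rewrite (raise_eq_box h) //.
  have -> : raise (fun _ _ _ => 0) i j k = 0.
    by rewrite /raise; case: (i) (j) (k) => [|?] [|?] [|?]; rewrite !addr0.
  move/esym/eqP; rewrite mulNr oppr_eq0 mulf_eq0 => /orP[|/eqP //].
  by move/pcharf0P: K0 => ->; rewrite muln_eq0 /= addn_eq0 subn_eq0 leqNgt ltdD.
apply: (van d.+1) => i j k hi hj hk; apply: hu => //.
by rewrite neq_ltn addnS ltnS leq_addl orbT.
Qed.

End SL2.

(** * The weak Lefschetz property of G *)

Section WeakLefschetz.
Variable K : fieldType.
Hypothesis K0 : [pchar K] =i pred0.
Variables gam2 gam3 gam4 mu nu : nat.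
Hypothesis mu_nu : (mu + nu = gam3.+1)%N.

Local Notation D := (gam2 + gam3 + gam4)%N.
Local Notation nf := (nf gam2 gam3 gam4 mu nu).
Local Notation B := ('I_gam2.+1 * 'I_gam3.+1 * 'I_gam4.+1)%type.
Let J : {mpoly K[3]} -> Prop := key_ideal nf.
Let gk := nf_gorenstein gam2 gam4 mu_nu.

Let c0 (e : B) : nat := e.1.1.
Let c1 (e : B) : nat := e.1.2.
Let c2 (e : B) : nat := e.2.
Let tr (e : B) := (c0 e, c1 e, c2 e).
Let dg (e : B) := (c0 e + c1 e + c2 e)%N.
Let bmon (e : B) := mon (c0 e) (c1 e) (c2 e).

Let c0_le e : (c0 e <= gam2)%N. Proof. by rewrite -ltnS ltn_ord. Qed.
Let c1_le e : (c1 e <= gam3)%N. Proof. by rewrite -ltnS ltn_ord. Qed.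
Let c2_le e : (c2 e <= gam4)%N. Proof. by rewrite -ltnS ltn_ord. Qed.

Let tr_inj : injective tr.
Proof.
by move=> [[a b] c] [[a' b'] c']; rewrite /tr /c0 /c1 /c2 /= => -[] /val_inj -> /val_inj -> /val_inj ->.
Qed.

Let box_tr i j k : (i <= gam2)%N -> (j <= gam3)%N -> (k <= gam4)%N ->
  exists e, tr e = (i, j, k).
Proof.
by move=> hi hj hk; exists (Ordinal (n:=gam2.+1) hi, Ordinal (n:=gam3.+1) hj, Ordinal (n:=gam4.+1) hk).
Qed.

Let nf_bmon e : nf (bmon e) = Some (tr e).
Proof. exact: nf_box. Qed.

(** Multiplication by y + z + w on the monomial complete intersection; a product outside the box
    matches no [tr e]. *)
Let M0 (e' e : B) : K :=
  (((c0 e').+1, c1 e', c2 e') == tr e)%:R + ((c0 e', (c1 e').+1, c2 e') == tr e)%:R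
  + ((c0 e', c1 e', (c2 e').+1) == tr e)%:R.

(** The extra term in G: multiplying by z at exponent [gam3] produces z^(gam3+1), which becomes y^mu
    w^nu. *)
Let N (e' e : B) : K :=
  ((c1 e' == gam3) && (((c0 e' + mu)%N, 0%N, (c2 e' + nu)%N) == tr e))%:R.

Let low e := (2 * dg e < D)%N.

Let ext (f : B -> K) i j k := \sum_e f e * (tr e == (i, j, k))%:R.

Let extE f e : ext f (c0 e) (c1 e) (c2 e) = f e.
Proof.
rewrite /ext (bigD1 e) //= eqxx mulr1 big1 ?addr0 // => e' ne.
by rewrite (inj_eq tr_inj) (negPf ne) mulr0.
Qed.

Let raise_ext f e : \sum_e' f e' * M0 e' e = raise (ext f) (c0 e) (c1 e) (c2 e).
Proof.
rewrite /raise /M0 /tr; under eq_bigr => e' _ do rewrite !mulrDr.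
rewrite !big_split /=; congr (_ + _ + _).
- case: (c0 e) => [|i]; first by rewrite big1 // => e' _; rewrite !xpair_eqE mulr0.
  by apply: eq_bigr => e' _; rewrite !xpair_eqE eqSS.
- case: (c1 e) => [|i]; first by rewrite big1 // => e' _; rewrite !xpair_eqE andbF mulr0.
  by apply: eq_bigr => e' _; rewrite !xpair_eqE eqSS.
- case: (c2 e) => [|i]; first by rewrite big1 // => e' _; rewrite !xpair_eqE andbF mulr0.
  by apply: eq_bigr => e' _; rewrite !xpair_eqE eqSS.
Qed.

Let M0_inj : injective_on low M0.
Proof.
move=> f flow fM e0.
have [lo|/flow //] := boolP (low e0).
(* The component of [f] in the degree of [e0], because [raise_injective] concerns a single
   degree. *)
pose v i j k := if (i + j + k == dg e0)%N then ext f i j k else 0.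
suff h : eq_box gam2 gam3 gam4 v (fun _ _ _ => 0).
  by have := h _ _ _ (c0_le e0) (c1_le e0) (c2_le e0); rewrite /v eqxx extE.
apply: (raise_injective K0 (d := dg e0)).
- by rewrite -mul2n.
- by move=> i j k _ _ _ /negPf ne; rewrite /v ne.
move=> i j k hi hj hk; have [e [<- <- <-]] := box_tr hi hj hk.
have -> : raise v (c0 e) (c1 e) (c2 e) =
  if (dg e == (dg e0).+1)%N then raise (ext f) (c0 e) (c1 e) (c2 e) else 0.
  rewrite /raise /v /dg; case: (c0 e) (c1 e) (c2 e) => [|x] [|y] [|z];
    rewrite ?addSn ?addnS ?eqSS ?addn0 ?add0n; case: (_ == _); rewrite ?addr0 //.
by rewrite -raise_ext fM; case: ifP.
Qed.

(** Complementary exponents: the monomials of [e] and [rho e] multiply to the top monomial of the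
    box. *)
Let rho (e : B) : B := (rev_ord e.1.1, rev_ord e.1.2, rev_ord e.2).

Let rhoK : involutive rho.
Proof. by move=> [[a b] c]; rewrite /rho /= !rev_ordK. Qed.

Let rhoE e : [/\ c0 (rho e) = gam2 - c0 e, c1 (rho e) = gam3 - c1 e
  & c2 (rho e) = gam4 - c2 e]%N.
Proof. by rewrite /c0 /c1 /c2 /= !subSS. Qed.

(** Multiplication is self-adjoint for the pairing by complements. *)
Let M0_rho e e' : M0 (rho e) (rho e') = M0 e' e.
Proof.
have [r0 r1 r2] := rhoE e; have [r0' r1' r2'] := rhoE e'.
have := (c0_le e, c1_le e, c2_le e, (c0_le e', c1_le e', c2_le e')).
move=> [[[? ?] ?] [[? ?] ?]].
rewrite /M0 /tr r0 r1 r2 r0' r1' r2' !xpair_eqE.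
by congr (_%:R + _%:R + _%:R); congr (nat_of_bool _); apply/idP/idP; lia.
Qed.

Let N_rho e e' : N (rho e) (rho e') = N e' e.
Proof.
have [r0 r1 r2] := rhoE e; have [r0' r1' r2'] := rhoE e'.
have := (c0_le e, c1_le e, c2_le e, (c0_le e', c1_le e', c2_le e')).
move=> [[[? ?] ?] [[? ?] ?]].
rewrite /N /tr r0 r1 r2 r0' r1' r2' !xpair_eqE.
by congr (_%:R); congr (nat_of_bool _); apply/idP/idP; lia.
Qed.

Let fibre_out e (p : {mpoly K[3]}) : (forall b, tr b <> e) -> fibre_coef nf e p = 0.
Proof.
case: e => [[i j] k] h; rewrite /fibre_coef big1 // => m /eqP/nf_some [hi hj hk].
by have [b /h] := box_tr hi hj hk.
Qed.

Let fibre_homog d e (p : {mpoly K[3]}) : p \is d.-homog -> dg e != d ->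
  fibre_coef nf (tr e) p = 0.
Proof.
move=> /dhomogP hp ne; rewrite /fibre_coef big_seq_cond big1 // => m.
by move=> /andP[/hp dm /eqP/(nf_deg mu_nu)]; rewrite dm => E; rewrite E eqxx in ne.
Qed.

Let J_ext (p : {mpoly K[3]}) : (forall e, fibre_coef nf (tr e) p = 0) -> J p.
Proof.
move=> h e; have [/existsP[b /eqP <- //]|] := boolP [exists b, tr b == e].
by rewrite negb_exists => /forallP nb; apply: fibre_out => b /eqP; rewrite (negPf (nb b)).
Qed.

Let nf_expand (p : {mpoly K[3]}) : J (p - \sum_e fibre_coef nf (tr e) p *: 'X_[bmon e]).
Proof.
apply: J_ext => e; rewrite linearB linear_sum /= (bigD1 e) //= big1 => [|e' ne].
  by rewrite linearZ /= fibre_coefX nf_bmon eqxx mulr1 addr0 subrr.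
by rewrite linearZ /= fibre_coefX nf_bmon (inj_eq Some_inj) (inj_eq tr_inj) (negPf ne) mulr0.
Qed.

Section Scaling.
Variable s : K.
Let L : {mpoly K[3]} := vy + s *: vz + vw.
Let Ms e' e := fibre_coef nf (tr e) (L * 'X_[bmon e']).

Let L_coef (p : {mpoly K[3]}) e :
  fibre_coef nf (tr e) (L * p) = \sum_e' fibre_coef nf (tr e') p * Ms e' e.
Proof.
have [_ _ JM] := key_ideal_is_ideal K gk.
have := JM L _ (nf_expand p) (tr e).
rewrite mulrBr linearB /= mulr_sumr linear_sum /= => /eqP; rewrite subr_eq0 => /eqP ->.
by apply: eq_bigr => e' _; rewrite -scalerAr linearZ.
Qed.

(* Rescaling the basis element y^i z^j w^k by s^j turns multiplication by L
   into a perturbation of multiplication by y + z + w on the monomial complete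
   intersection. *)
Let Ms_scale e' e : s ^+ c1 e' * Ms e' e = (M0 e' e + s ^+ gam3.+1 * N e' e) * s ^+ c1 e.
Proof.
have E1 : Ms e' e = (((c0 e').+1, c1 e', c2 e') == tr e)%:R
   + s * (nf (mon (c0 e') (c1 e').+1 (c2 e')) == Some (tr e))%:R
   + ((c0 e', c1 e', (c2 e').+1) == tr e)%:R.
  have Xy : vy = 'X_[mon 1 0 0] :> {mpoly K[3]} by rewrite mpolyX_mon !mulr1.
  have Xz : vz = 'X_[mon 0 1 0] :> {mpoly K[3]} by rewrite mpolyX_mon mulr1 mul1r.
  have Xw : vw = 'X_[mon 0 0 1] :> {mpoly K[3]} by rewrite mpolyX_mon !mul1r.
  rewrite /Ms /L !mulrDl -scalerAl !linearD linearZ /= Xy Xz Xw -!mpolyXD !fibre_coefX.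
  rewrite /bmon !monD !add0n !add1n; congr (_%:R + _ + _%:R); congr (nat_of_bool _).
    have := c0_le e'; rewrite leq_eqVlt => /predU1P[h|h].
      rewrite /nf !monE h [X in if X && _ then _ else _]leqNgt ltn_addr //=.
      by apply/esym/negP => /eqP[h0 _ _]; have := c0_le e; rewrite -h0 ltnn.
    by rewrite nf_box.
  have := c2_le e'; rewrite leq_eqVlt => /predU1P[h|h].
    rewrite /nf !monE h [X in if _ && X then _ else _]leqNgt ltn_addr //= andbF.
    by apply/esym/negP => /eqP[_ _ h0]; have := c2_le e; rewrite -h0 ltnn.
  by rewrite nf_box.
rewrite E1 /M0 /N.
(* At [z]-exponent [gam3] the rule resets the exponent to 0; the factor [s] from [L] and the scaling
   [s^gam3] make up [s^(gam3+1)]. *)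
have [eq3|ne3] := eqVneq (c1 e') gam3.
  have -> : (nf (mon (c0 e') (c1 e').+1 (c2 e')) == Some (tr e))
     = (((c0 e' + mu)%N, 0%N, (c2 e' + nu)%N) == tr e).
    rewrite /nf !monE eq3 divnn modnn !mul1n; case: ifP => // /negbT h.
    apply/esym/negP => /eqP[h0 _ h2]; move: h; rewrite h0 h2 c0_le c2_le //.
  have -> : ((c0 e', (c1 e').+1, c2 e') == tr e) = false.
    by apply/negP => /eqP[_ h _]; have := c1_le e; rewrite -h eq3 ltnn.
  rewrite addr0 /= !mulrDr !mulrDl -!addrA; congr (_ + _).
    by case: eqP => [[_ -> _]|]; rewrite ?mulr0 ?mul0r ?mulr1 ?mul1r.
  rewrite addrC; congr (_ + _).
    by case: eqP => [[_ -> _]|]; rewrite ?mulr0 ?mul0r ?mulr1 ?mul1r.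
  case: eqP => [[_ <- _]|_]; last by rewrite !mulr0 mul0r.
  by rewrite expr0 !mulr1 eq3 exprSr.
have lt3 : (c1 e' < gam3)%N by rewrite ltn_neqAle ne3 c1_le.
rewrite nf_box //= mulr0 addr0 !mulrDr !mulrDl; congr (_ + _ + _).
- by case: eqP => [[_ -> _]|]; rewrite ?mulr0 ?mul0r ?mulr1 ?mul1r.
- rewrite (inj_eq Some_inj).
  by case: eqP => [[_ <- _]|]; rewrite ?mulr0 ?mul0r ?mulr1 ?mul1r // exprSr.
- by case: eqP => [[_ -> _]|]; rewrite ?mulr0 ?mul0r ?mulr1 ?mul1r.
Qed.

Let Mt_deg e' e : M0 e' e + s ^+ gam3.+1 * N e' e != 0 -> dg e = (dg e').+1.
Proof.
move=> ne0; apply/eqP; apply: contraR ne0 => /eqP ne; rewrite /M0 /N /tr !xpair_eqE /=.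
have F (b : bool) : ~~ b -> b%:R = 0 :> K by move/negPf ->.
rewrite !F ?mulr0 ?addr0 //; apply/negP => h; apply: ne; move: h; rewrite /dg; lia.
Qed.

Hypothesis s_neq0 : s != 0.
Hypothesis Mt_inj : injective_on low (fun e' e => M0 e' e + s ^+ gam3.+1 * N e' e).

Let s_unit (n : nat) : s ^+ n != 0. Proof. exact: expf_neq0. Qed.

(** If [2 d < D], rescaling carries the injectivity over to [L]. Otherwise [d.+1] lies above the
    middle degree, where duality turns injectivity into surjectivity. *)
Lemma WLP_of_injective : WLP J.
Proof.
exists L; split.
  by rewrite !rpredD ?rpredZ // dhomogX; apply/eqP/mdeg1.
move=> d; have [lo|hi] := ltnP (2 * d) D; [left|right] => q hq.
  move=> JLq; apply: J_ext => e.
  suff : fibre_coef nf (tr e) q * s ^- c1 e = 0.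
    by move/eqP; rewrite mulf_eq0 invr_eq0 (negPf (s_unit _)) orbF => /eqP.
  apply: (Mt_inj (f := fun e => fibre_coef nf (tr e) q * s ^- c1 e)) => {e} e.
    move=> nlo; rewrite (fibre_homog hq) ?mul0r //; apply: contraNneq nlo => dge.
    by rewrite /low dge.
  apply: (mulIf (s_unit (c1 e))); rewrite mul0r -[RHS](JLq (tr e)) L_coef mulr_suml.
  apply: eq_bigr => e' _; rewrite -!mulrA -Ms_scale; congr (_ * _).
  by rewrite mulrA mulVf ?mul1r.
have rho_low e : (D < 2 * dg (rho e))%N = low e.
  have [r0 r1 r2] := rhoE e; have := (c0_le e, c1_le e, c2_le e) => -[[? ?] ?].
  by rewrite /low /dg r0 r1 r2; apply/idP/idP; lia.
pose Mt e' e := M0 e' e + s ^+ gam3.+1 * N e' e.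
have Mt_rho e e' : Mt (rho e) (rho e') = Mt e' e by rewrite /Mt M0_rho N_rho.
have Mt_inj' : injective_on (fun e => D < 2 * dg (rho e))%N Mt.
  by move=> f flow; apply: Mt_inj => e nlo; apply: flow; rewrite rho_low.
have [f hf] := dual_surjective (S := fun e => (D < 2 * dg e)%N) rhoK Mt_rho Mt_inj'
  (fun e => fibre_coef nf (tr e) q * s ^- c1 e).
(* Only the part of [f] in degree [d] is kept: the rest does not contribute in degree [d.+1]. *)
pose p : {mpoly K[3]} := \sum_(e | dg e == d) (f e * s ^+ c1 e) *: 'X_[bmon e].
have hp : p \is d.-homog.
  by apply: rpred_sum => e /eqP dge; rewrite rpredZ // dhomogX -dge; apply/eqP/mdeg_mon.
exists p; split => //; apply: J_ext => e.
rewrite linearB /= /p mulr_sumr linear_sum /=.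
have -> : \sum_(e' | dg e' == d) fibre_coef nf (tr e) (L * ((f e' * s ^+ c1 e') *: 'X_[bmon e']))
  = (\sum_(e' | dg e' == d) f e' * (M0 e' e + s ^+ gam3.+1 * N e' e)) * s ^+ c1 e.
  rewrite mulr_suml; apply: eq_bigr => e' _.
  by rewrite -scalerAr linearZ /= -/(Ms e' e) -!mulrA Ms_scale.
have [dge|ne] := eqVneq (dg e) d.+1; last first.
  rewrite (fibre_homog hq) // big1 ?mul0r ?subrr // => e' /eqP dge'.
  have [->|/Mt_deg] := eqVneq (M0 e' e + s ^+ gam3.+1 * N e' e) 0; first by rewrite mulr0.
  by rewrite dge' => /eqP; rewrite (negPf ne).
have -> : \sum_(e' | dg e' == d) f e' * (M0 e' e + s ^+ gam3.+1 * N e' e)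
   = fibre_coef nf (tr e) q * s ^- c1 e.
  rewrite -hf; last by rewrite dge mulnS; lia.
  rewrite [RHS](bigID (fun e' => dg e' == d)) /= [X in _ = _ + X]big1 ?addr0 // => e' ne.
  have [->|/Mt_deg] := eqVneq (Mt e' e) 0; first by rewrite mulr0.
  by rewrite dge => -[] /eqP; rewrite eq_sym (negPf ne).
by rewrite -mulrA mulVf // mulr1 subrr.
Qed.

End Scaling.

Lemma nf_WLP : WLP J.
Proof.
have [s s_gt0 inj] := generic_injective_on K0 N (ltn0Sn gam3) M0_inj.
by apply: (WLP_of_injective _ inj); apply: natr_neq0; rewrite -?lt0n.
Qed.

End WeakLefschetz.

(** * Maximal representations *)

Section Representations.
Local Open Scope nat_scope.
Variables (n : nat) (g : n.+1.-tuple nat).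
Hypothesis g_gt0 : forall i, 0 < tnth g i.
Implicit Types (l : 'I_n.+1 -> nat) (m u : 'X_{1..n}).

Lemma reps_ffun l s : \sum_i l i * tnth g i = s ->
  exists2 f : {ffun 'I_n.+1 -> 'I_s.+1}, f \in reps g s & forall i, f i = l i :> nat.
Proof.
move=> ls; have lt_ls i : l i < s.+1.
  by rewrite ltnS -ls (bigD1 i) //= (leq_trans _ (leq_addr _ _)) // leq_pmulr.
exists [ffun i => inord (l i)] => [|i]; last by rewrite ffunE inordK.
by rewrite inE; apply/eqP; rewrite -[RHS]ls; apply: eq_bigr => i _; rewrite ffunE inordK.
Qed.

Lemma in_sgP s : reflect (exists l, \sum_i l i * tnth g i = s) (in_sg g s).
Proof.
rewrite /in_sg; apply: (iffP (set0Pn _)) => [[f] | [l /reps_ffun[f fs _]]]; last by exists f.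
by rewrite inE => /eqP fs; exists (fun i => f i : nat).
Qed.

Lemma rep_size_le l s : \sum_i l i * tnth g i = s -> \sum_i l i <= sg_ord g s.
Proof.
move=> /reps_ffun[f fs fl].
rewrite (eq_bigr (fun i => f i : nat)); last by move=> i _; rewrite fl.
exact: (@leq_bigmax_cond _ _ (@rep_size n s) f fs).
Qed.

Lemma sg_ord_attained s : in_sg g s ->
  exists2 l, \sum_i l i * tnth g i = s & \sum_i l i = sg_ord g s.
Proof.
move=> /set0Pn[f0 f0s]; rewrite /sg_ord.
have [|f fs ->] := @eq_bigmax_cond _ (mem (reps g s)) (@rep_size n s).
  by apply/card_gt0P; exists f0.
by exists (fun i => f i : nat) => //; move: fs; rewrite /= inE => /eqP.
Qed.

Lemma in_sgD s s' : in_sg g s -> in_sg g s' -> in_sg g (s + s').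
Proof.
move=> /in_sgP[l <-] /in_sgP[l' <-]; apply/in_sgP; exists (fun i => l i + l' i).
by rewrite -big_split; apply: eq_bigr => i _; rewrite mulnDl.
Qed.

Lemma sg_ordD s s' : in_sg g s -> in_sg g s' ->
  sg_ord g s + sg_ord g s' <= sg_ord g (s + s').
Proof.
move=> /sg_ord_attained[l ls <-] /sg_ord_attained[l' ls' <-].
rewrite -big_split; apply: rep_size_le; rewrite -ls -ls' -big_split.
by apply: eq_bigr => i _; rewrite mulnDl.
Qed.

Lemma in_apery_sg s : in_apery g s -> in_sg g s.
Proof. by case/andP. Qed.

(** Otherwise [s' - g_1], and with it [s + s' - g_1], would lie in the semigroup. *)
Lemma in_apery_down s s' : in_sg g s -> in_sg g s' -> in_apery g (s + s') ->
  in_apery g s'.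
Proof.
move=> hs hs' /andP[_ h]; rewrite /in_apery hs' /=; case: ltnP => //= le.
apply: contraTN h => /(in_sgD hs); rewrite addnBA // => -> /=.
by rewrite orbF -leqNgt (leq_trans le) ?leq_addl.
Qed.

(** A positive coefficient of the multiplicity could be lowered by one, which would put [s - g_1] in
    the semigroup. *)
Lemma in_apery_rep0 l s : in_apery g s -> \sum_i l i * tnth g i = s -> l ord0 = 0.
Proof.
move=> /andP[_ h] ls; apply/eqP; apply: contraTT h; rewrite -lt0n => l0.
have le : tnth g ord0 <= s.
  by rewrite -ls (bigD1 ord0) //= (leq_trans _ (leq_addr _ _)) // leq_pmull.
rewrite negb_or -leqNgt le negbK /=; apply/in_sgP.
exists (fun i => if i == ord0 then (l i).-1 else l i).
rewrite -ls (bigD1 ord0) // [in RHS](bigD1 ord0) //= -subn1 mulnBl mul1n.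
rewrite addnBAC ?leq_pmull //; congr (_ + _ - _).
by apply: eq_bigr => i /negPf ->.
Qed.

(** The first generator occurs in no representation of an Apery element, so these representations
    are the monomials in the remaining variables. *)
Definition wt m := \sum_i m i * tnth g (lift ord0 i).

Definition mrep m (i : 'I_n.+1) : nat := if unlift ord0 i is Some j then m j else 0.

Lemma sum_mrep m : \sum_i mrep m i * tnth g i = wt m.
Proof.
rewrite big_ord_recl /mrep unlift_none mul0n add0n.
by apply: eq_bigr => i _; rewrite liftK.
Qed.

Lemma size_mrep m : \sum_i mrep m i = mdeg m.
Proof.
rewrite big_ord_recl /mrep unlift_none add0n mdegE.
by apply: eq_bigr => i _; rewrite liftK.
Qed.

Lemma wtD m u : wt (m + u)%MM = wt m + wt u.
Proof. by rewrite /wt -big_split; apply: eq_bigr => i _; rewrite mnmDE mulnDl. Qed.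

Lemma wt1 i k : wt (U_(i) *+ k)%MM = k * tnth g (lift ord0 i).
Proof.
rewrite /wt (bigD1 i) //= big1 => [|j /negPf ne]; rewrite mulmnE mnm1E.
  by rewrite eqxx mul1n addn0.
by rewrite eq_sym ne.
Qed.

Lemma in_sg_wt m : in_sg g (wt m).
Proof. by apply/in_sgP; exists (mrep m); rewrite sum_mrep. Qed.

Lemma mdeg_le_ord m : mdeg m <= sg_ord g (wt m).
Proof. by rewrite -size_mrep; apply: rep_size_le; rewrite sum_mrep. Qed.

Lemma apery_rep s l : in_apery g s -> \sum_i l i * tnth g i = s ->
  exists m, [/\ wt m = s, mdeg m = \sum_i l i & forall i, l i = mrep m i].
Proof.
move=> As ls; have l0 := in_apery_rep0 As ls.
pose m := [multinom l (lift ord0 i) | i < n].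
have lm i : l i = mrep m i.
  by rewrite /mrep; case: unliftP => [j|] ->; rewrite ?mnmE.
exists m; split=> //; first by rewrite -sum_mrep -ls; apply: eq_bigr => i _; rewrite lm.
by rewrite -size_mrep; apply: eq_bigr => i _; rewrite lm.
Qed.

(* The value of [m], provided that [m] is a maximal representation of an
   element of the Apery set. *)
Definition apery_key m : option nat :=
  if in_apery g (wt m) && (sg_ord g (wt m) == mdeg m) then Some (wt m) else None.

Lemma apery_keyP m s : apery_key m = Some s <->
  [/\ in_apery g s, wt m = s & mdeg m = sg_ord g s].
Proof.
rewrite /apery_key; split=> [|[As em dm]]; last by rewrite em dm As eqxx.
  by case: ifP => // /andP[? /eqP ?] [<-].
Qed.

Lemma eq_apery_key m m' : wt m = wt m' -> mdeg m = mdeg m' ->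
  apery_key m = apery_key m'.
Proof. by rewrite /apery_key => -> ->. Qed.

Lemma apery_key_eq m m' : apery_key m = apery_key m' -> apery_key m != None ->
  wt m = wt m' /\ mdeg m = mdeg m'.
Proof.
case E: (apery_key m) => [s|//] /esym E' _.
by case/apery_keyP: E => _ -> ->; case/apery_keyP: E' => _ -> ->.
Qed.

(** A factor of a maximal representation of an Apery element is again one: the Apery set is closed
    under divisors and the order is superadditive. *)
Lemma apery_key_absorb u m : apery_key m = None -> apery_key (u + m)%MM = None.
Proof.
move=> h; case E: (apery_key _) => [s|//]; case/apery_keyP: E => As; rewrite wtD mdegD.
move=> es ed; rewrite -es in As ed.
have Am := in_apery_down (in_sg_wt u) (in_sg_wt m) As.
have := sg_ordD (in_sg_wt u) (in_sg_wt m); rewrite -ed => le.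
have em : mdeg m = sg_ord g (wt m).
  by have := mdeg_le_ord m; have := mdeg_le_ord u; lia.
by have /apery_keyP : [/\ in_apery g (wt m), wt m = wt m & mdeg m = sg_ord g (wt m)] by []; rewrite h.
Qed.

Lemma apery_key_max s : in_apery g s -> exists m, apery_key m = Some s.
Proof.
move=> As; have [l ls lo] := sg_ord_attained (in_apery_sg As).
have [m [ms md _]] := apery_rep As ls.
by exists m; apply/apery_keyP; rewrite md.
Qed.

(** The top [t] is a maximal representation of the largest Apery element. A maximal representation
    of any other is completed to one of it by that of the symmetric element, as both values and
    orders add up. *)
Lemma apery_gorenstein : M_pure_symmetric g ->
  exists t, gorenstein_key apery_key t.
Proof.
case=> w [w_sorted mem_w size_w w_sym].
set r := tnth g ord0 in size_w w_sym; have r_gt0 : 0 < r := g_gt0 ord0.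
have lt_r1 : r.-1 < size w by rewrite size_w prednK.
have Ar : in_apery g (nth 0 w r.-1) by rewrite -mem_w mem_nth.
have [t kt] := apery_key_max Ar.
exists t; split=> [||u m m'|m m'||m]; rewrite ?kt //.
- exact: apery_key_absorb.
- move=> u m m' h; case E: (apery_key m) => [s|]; last by rewrite !apery_key_absorb -?h.
  have [|ew ed] := apery_key_eq h; first by rewrite E.
  by apply: eq_apery_key; rewrite ?wtD ?mdegD ?ew ?ed.
- move=> h h0; have [] := apery_key_eq h h0; rewrite !wtD !mdegD.
  by move=> /addnI ew /addnI ed; apply: eq_apery_key.
- by move=> h h0; case: (apery_key_eq h h0).
case E: (apery_key m) => [s|//] _; case/apery_keyP: E => As em dm.
have sw : s \in w by rewrite mem_w.
pose i := index s w; have lt_i : i < r by rewrite -size_w index_mem.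
have [] := w_sym i lt_i; rewrite nth_index // => e1 e2.
have As' : in_apery g (nth 0 w (r.-1 - i)).
  by rewrite -mem_w mem_nth // (leq_ltn_trans (leq_subr _ _)).
have [u /apery_keyP[_ eu du]] := apery_key_max As'.
by exists u; apply/apery_keyP; rewrite wtD mdegD em eu dm du addnC e1 addnC.
Qed.

(** * Powers of one generator and the integers gamma *)

Section Gamma.
Variables (i : 'I_n) (h : nat).
Let x := tnth g (lift ord0 i).
Hypothesis gamma : is_gamma g x h.

Let P k := [&& in_apery g (k * x), sg_ord g (k * x) == k & #|max_reps g (k * x)| == 1].

Let unique k := forall m, mdeg m = k -> wt m = k * x -> m = (U_(i) *+ k)%MM.

Let mdegk k : mdeg (U_(i) *+ k)%MM = k.
Proof. by rewrite mdegMn mdeg1 mul1n. Qed.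

Lemma gamma_key : apery_key (U_(i) *+ h)%MM != None.
Proof. by case: gamma => /and3P[Ah oh _] _; rewrite /apery_key mdegk wt1 Ah oh. Qed.

Lemma gamma_unique : unique h.
Proof.
case: gamma => /and3P[Ah /eqP oh /cards1P[f0 f0E]] _.
have f0P m : mdeg m = h -> wt m = h * x -> forall j, f0 j = mrep m j :> nat.
  move=> dm wm; have [f fs fm] := @reps_ffun (mrep m) (h * x) (etrans (sum_mrep m) wm).
  suff -> : f0 = f by [].
  apply/eqP; rewrite eq_sym -in_set1 -f0E inE fs oh /=; apply/eqP.
  by rewrite -[RHS]dm -size_mrep; apply: eq_bigr.
move=> m dm wm; apply/mnmP => j.
have := f0P m dm wm (lift ord0 j); rewrite (f0P (U_(i) *+ h)%MM) ?mdegk ?wt1 //.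
by rewrite /mrep liftK.
Qed.

(** Otherwise [h.+1] would contradict the maximality of gamma; [unique] supplies the condition on
    the number of maximal representations. *)
Lemma gamma_next : unique h.+1 -> apery_key (U_(i) *+ h.+1)%MM = None.
Proof.
move=> uh; case E: (apery_key _) => [s|//].
case/apery_keyP: E; rewrite wt1 -/x mdegk => As es os; rewrite -es in As os.
suff /gamma.2 : P h.+1 by rewrite ltnn.
rewrite /P As -os eqxx /=; apply/cards1P.
have [f fs fm] := reps_ffun (etrans (sum_mrep (U_(i) *+ h.+1)%MM) (wt1 i h.+1)).
exists f; apply/setP => f'; rewrite !inE; apply/andP/eqP => [[/eqP f's /eqP f'o]|->].
  have [m [wm dm mE]] := apery_rep As f's.
  apply/ffunP => j; apply: val_inj; rewrite /= fm mE (uh m) //.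
  by rewrite dm; apply/etrans/esym/os; rewrite -f'o.
move: fs; rewrite inE => ->; split=> //; rewrite -os /rep_size.
by rewrite (eq_bigr (mrep (U_(i) *+ h.+1)%MM)) ?size_mrep ?mdegk.
Qed.

End Gamma.

End Representations.

(** * The ideal of the associated graded algebra *)

Section AperyIdeal.
Variables (K : fieldType) (n : nat) (g : n.+1.-tuple nat).
Hypothesis g_gt0 : forall i, (0 < tnth g i)%N.
Implicit Types (a b q : {poly K}) (p : {mpoly K[n]}) (l : 'I_n.+1 -> nat).

Local Notation R := (@sg_ring K n g).
Local Notation M := (@sg_max_ideal K n g).

Lemma mmap1_Xn (I : nat) (e : 'I_I -> nat) (m : 'X_{1..I}) :
  mmap1 (fun i => 'X^(e i)) m = 'X^(\sum_i m i * e i) :> {poly K}.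
Proof.
rewrite /mmap1 (eq_bigr (fun i => 'X^(m i * e i))).
  by rewrite prodrXr.
by move=> i _; rewrite -exprM mulnC.
Qed.

(* Since the order of an element is superadditive, these polynomials contain the
   [k]-th power of the maximal ideal. *)
Definition ord_ge k q := forall v, q`_v != 0 -> in_sg g v && (k <= sg_ord g v)%N.

Lemma ord_geD k a b : ord_ge k a -> ord_ge k b -> ord_ge k (a + b).
Proof.
move=> ha hb v; rewrite coefD; have [->|/ha //] := eqVneq a`_v 0.
by rewrite add0r; apply: hb.
Qed.

Lemma ord_ge_sum k (T : eqType) (r : seq T) (F : T -> {poly K}) :
  (forall x, x \in r -> ord_ge k (F x)) -> ord_ge k (\sum_(x <- r) F x).
Proof.
move=> h; rewrite big_seq; apply: big_ind => //; last exact: ord_geD.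
by move=> v; rewrite coef0 eqxx.
Qed.

Lemma ord_geM j k a b : ord_ge j a -> ord_ge k b -> ord_ge (j + k) (a * b).
Proof.
move=> ha hb v; rewrite coefM => nz.
have [i nzi] : exists i : 'I_v.+1, a`_i * b`_(v - i) != 0.
  apply/existsP; apply: contraNT nz; rewrite negb_exists => /forallP h.
  by rewrite big1 // => i _; apply/eqP; move: (h i); rewrite negbK.
move: nzi; rewrite mulf_eq0 negb_or => /andP[/ha /andP[sa oa] /hb /andP[sb ob]].
have e : (i + (v - i) = v)%N by rewrite subnKC // -ltnS.
have := in_sgD g_gt0 sa sb; have := sg_ordD g_gt0 sa sb; rewrite e => le ->.
by rewrite (leq_trans (leq_add oa ob) le).
Qed.

Lemma ord_geX l (c : K) k : (k <= \sum_i l i)%N ->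
  ord_ge k (c%:P * 'X^(\sum_i l i * tnth g i)%N).
Proof.
move=> le v; rewrite coefCM coefXn; have [->|_] := eqVneq v; last by rewrite mulr0 eqxx.
move=> _; rewrite (leq_trans le (rep_size_le g_gt0 _)) // andbT.
by apply/(in_sgP g_gt0); exists l.
Qed.

Lemma ord_ge_sg_ring q : R q -> ord_ge 0 q.
Proof.
case=> P ->; rewrite /mmap; apply: ord_ge_sum => m _; rewrite mmap1_Xn.
exact: ord_geX.
Qed.

Lemma ord_ge_ideal_gen k (X : {poly K} -> Prop) : (forall x, X x -> ord_ge k x) ->
  forall q, ideal_gen R X q -> ord_ge k q.
Proof.
move=> h q [s [hs ->]]; apply: ord_ge_sum => u /hs[/ord_ge_sg_ring h1 /h h2].
exact: ord_geM h1 h2.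
Qed.

Let Xgen i : 'X^(tnth g i) = 1%:P * 'X^(\sum_j (i == j) * tnth g j)%N :> {poly K}.
Proof.
rewrite mul1r; congr ('X^_); rewrite (bigD1 i) //= eqxx mul1n big1 ?addn0 //.
by move=> j /negPf ne; rewrite eq_sym ne.
Qed.

Lemma ord_ge_ideal_pow k q : ideal_pow R M k q -> ord_ge k q.
Proof.
elim: k q => [|k IHk] q; first exact: ord_ge_sg_ring.
apply: ord_ge_ideal_gen => _ [a [b [Ma /IHk hb ->]]]; rewrite -add1n.
apply: ord_geM hb; apply: ord_ge_ideal_gen Ma => _ [i ->]; rewrite Xgen.
by apply: ord_geX; rewrite (bigD1 i) //= eqxx leq_addr.
Qed.

Lemma sg_ringX l (c : K) : R (c%:P * 'X^(\sum_i l i * tnth g i)%N).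
Proof.
exists (c *: 'X_[[multinom l i | i < n.+1]]); rewrite mmapZ mmapX mmap1_Xn.
by congr (_ * 'X^_); apply: eq_bigr => i _; rewrite mnmE.
Qed.

Lemma sg_ringD a b : R a -> R b -> R (a + b).
Proof. by move=> [P ->] [Q ->]; exists (P + Q); rewrite mmapD. Qed.

Lemma sg_ring0 : R 0.
Proof. by exists 0; rewrite mmap0. Qed.

Lemma ideal_genD (X : {poly K} -> Prop) a b :
  ideal_gen R X a -> ideal_gen R X b -> ideal_gen R X (a + b).
Proof.
move=> [s [hs ->]] [s' [hs' ->]]; exists (s ++ s'); rewrite big_cat; split=> // u.
by rewrite mem_cat => /orP[/hs|/hs'].
Qed.

Lemma mem_ideal_gen (X : {poly K} -> Prop) r x : R r -> X x -> ideal_gen R X (r * x).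
Proof.
move=> Rr Xx; exists [:: (r, x)]; rewrite big_seq1; split=> // u.
by rewrite inE => /eqP ->.
Qed.

Let sg_ringC (c : K) : R c%:P.
Proof.
have := sg_ringX (fun=> 0%N) c.
by under eq_bigr do rewrite mul0n; rewrite big1 // expr0 mulr1.
Qed.

(** Each induction step splits off one generator that occurs in [l]. *)
Lemma ideal_powX k l (c : K) : (k <= \sum_i l i)%N ->
  ideal_pow R M k (c%:P * 'X^(\sum_i l i * tnth g i)%N).
Proof.
elim: k l c => [|k IHk] l c le; first exact: sg_ringX.
have [i li] : exists i, l i != 0%N.
  apply/existsP; apply: contraTT le; rewrite negb_exists -leqNgt => /forallP h.
  by rewrite big1 // => i _; apply/eqP; move: (h i); rewrite negbK.
pose l' j := (l j - (i == j))%N.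
have El j : l j = ((i == j) + l' j)%N.
  by rewrite /l' subnKC //; case: eqP => // <-; rewrite lt0n.
apply: mem_ideal_gen; first exact: sg_ringC.
exists 'X^(tnth g i), (1%:P * 'X^(\sum_j l' j * tnth g j)%N); split.
- rewrite -[X in M X]mul1r; apply: mem_ideal_gen; last by exists i.
  exact: (sg_ringC 1).
- apply: IHk; move: le; rewrite (eq_bigr _ (fun j _ => El j)) big_split /=.
  by rewrite (bigD1 i) //= eqxx big1 ?addn0 // => j /negPf; rewrite eq_sym => ->.
rewrite [X in X * _]Xgen !mul1r -exprD -big_split; congr 'X^_.
by apply: eq_bigr => j _ /=; rewrite -mulnDl -El.
Qed.

Lemma ideal_powD k a b :
  ideal_pow R M k a -> ideal_pow R M k b -> ideal_pow R M k (a + b).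
Proof. by case: k => [|k]; [apply: sg_ringD | apply: ideal_genD]. Qed.

Lemma ideal_powZ k (c : K) a : ideal_pow R M k a -> ideal_pow R M k (c *: a).
Proof.
case: k => [[P ->]|k [s [hs ->]]]; first by exists (c *: P); rewrite mmapZ mul_polyC.
exists [seq (c *: u.1, u.2) | u <- s]; split=> [_ /mapP[u /hs[[P e] Xu] ->]|].
  by split=> //=; exists (c *: P); rewrite mmapZ mul_polyC e.
by rewrite big_map scaler_sumr; apply: eq_bigr => u _; rewrite scalerAl.
Qed.

Lemma ideal_pow0 k : ideal_pow R M k 0.
Proof.
case: k => [|k]; first exact: sg_ring0.
by exists [::]; rewrite big_nil.
Qed.

Local Notation wt := (wt g).
Local Notation key := (apery_key g).

Lemma apery_evalE p : apery_eval g p = \sum_(m <- msupp p) p@_m *: 'X^(wt m).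
Proof. by apply: eq_bigr => m _; rewrite mmap1_Xn mul_polyC. Qed.

Lemma apery_eval_X m : apery_eval (K := K) g 'X_[m] = 'X^(wt m).
Proof. by rewrite /apery_eval mmapX mmap1_Xn. Qed.

Lemma apery_evalD p p' : apery_eval g (p + p') = apery_eval g p + apery_eval g p'.
Proof. exact: mmapD. Qed.

Lemma apery_evalZ (c : K) p : apery_eval g (c *: p) = c *: apery_eval g p.
Proof. by rewrite /apery_eval mmapZ mul_polyC. Qed.

(** For one inclusion, compare the coefficients of t^s in degree [sg_ord g s]: for [s] in the Apery
    set, neither the next power of the maximal ideal nor the multiples of t^(g_1) contain t^s. For
    the other, a monomial without key has order above its degree or a value divisible by t^(g_1),
    and monomials with the same key have the same value and degree. *)
Lemma apery_ideal_key : ideal_eq (apery_ideal K g) (key_ideal key).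
Proof.
move=> p; split=> [Ip s | pI d].
  have [As|nAs] := boolP (in_apery g s); last first.
    rewrite /fibre_coef big1 // => m /eqP/apery_keyP[As].
    by rewrite As in nAs.
  have [a [b [/ord_ge_ideal_pow ha /ord_ge_sg_ring hb E]]] := Ip (sg_ord g s).
  have as0 : a`_s = 0 by apply/eqP; apply: contraT => /ha; rewrite ltnn andbF.
  have bs0 : ('X^(tnth g ord0) * b)`_s = 0.
    rewrite coefXnM; case: ltnP => // le; apply/eqP; apply: contraT => /hb.
    by case/andP: As => _; rewrite ltnNge le /= => /negPf ->.
  have := congr1 (fun q => q`_s) E; rewrite /= coefD as0 bs0 addr0 => <-.
  have -> (q : {mpoly K[n]}) : (apery_eval g q)`_s = fibre_coef (fun m => Some (wt m)) s q.
    rewrite apery_evalE coef_sum [RHS]big_mkcond; apply: eq_bigr => m _.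
    rewrite coefZ coefXn eq_sym (inj_eq Some_inj).
    by case: eqP; rewrite ?mulr1 ?mulr0.
  rewrite pihomogE linear_sum [RHS]big_mkcond [LHS]big_mkcond; apply: eq_bigr => m _ /=.
  rewrite linearZ /= fibre_coefX (inj_eq Some_inj).
  have -> : (key m == Some s) = (mdeg m == sg_ord g s) && (wt m == s).
    by apply/eqP/andP => [/apery_keyP[_ -> ->]|[/eqP ? /eqP ?]]; [|apply/apery_keyP].
  by case: (mdeg m == _); case: (wt m == s); rewrite ?mulr1 ?mulr0.
pose Q x := exists a b, [/\ ideal_pow R M d.+1 a, R b & x = a + 'X^(tnth g ord0) * b].
have Q0 : Q 0 by exists 0, 0; rewrite mulr0 addr0; split; [exact: ideal_pow0 | exact: sg_ring0|].
have QD x y : Q x -> Q y -> Q (x + y).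
  move=> [a [b [ha hb ->]]] [a' [b' [ha' hb' ->]]]; exists (a + a'), (b + b').
  by rewrite mulrDr addrACA; split; [exact: ideal_powD | exact: sg_ringD|].
have QZ c x : Q x -> Q (c *: x).
  move=> [a [b [ha [P hb] ->]]]; exists (c *: a), (c *: b); rewrite scalerDr scalerAr.
  by split; [exact: ideal_powZ | exists (c *: P); rewrite mmapZ mul_polyC hb|].
apply: (key_ideal_sub (J := fun p => Q (apery_eval g (pihomog mdeg d p))) _ _ _ _ _ pI).
- by rewrite pihomog0 /apery_eval mmap0.
- by move=> q q'; rewrite pihomogD apery_evalD; apply: QD.
- by move=> c q; rewrite linearZ apery_evalZ; apply: QZ.
- move=> m km; rewrite pihomogX; case: eqP => [dm|_]; last by rewrite /apery_eval mmap0.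
  rewrite apery_eval_X; have sm := in_sg_wt g_gt0 m.
  have [lt|le] := ltnP d (sg_ord g (wt m)).
    have [l ls lo] := sg_ord_attained sm.
    exists 'X^(wt m), 0; rewrite mulr0 addr0; split=> //; last exact: sg_ring0.
    by rewrite -ls -[X in ideal_pow _ _ _ X]mul1r; apply: (ideal_powX 1); rewrite lo.
  have od : sg_ord g (wt m) = mdeg m.
    by apply/eqP; rewrite eqn_leq mdeg_le_ord // andbT dm.
  move: km; rewrite /apery_key od eqxx andbT; case: ifP => // /negbT + _.
  rewrite /in_apery sm /= negb_or -leqNgt negbK => /andP[le0 /(in_sgP g_gt0)[l ls]].
  exists 0, 'X^(wt m - tnth g ord0); rewrite add0r -exprD subnKC //.
  split=> //; first exact: ideal_pow0.
  by rewrite -ls -[X in sg_ring _ X]mul1r; apply: (sg_ringX _ 1).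
move=> m m' e ne; have [ew ed] := apery_key_eq e ne.
have EX u : pihomog mdeg d 'X_[u] = if mdeg u == d then 'X_[u] else 0 :> {mpoly K[n]}.
  exact: pihomogX.
rewrite raddfB /= !EX ed; case: ifP => _; last by rewrite subrr /apery_eval mmap0.
by rewrite /apery_eval mmapB -!/(apery_eval g _) !apery_eval_X ew subrr.
Qed.

End AperyIdeal.

(** * Transport along equality of ideals *)

Section Extensionality.
Variables (K : fieldType) (n : nat) (I J : {mpoly K[n]} -> Prop).
Hypothesis IJ : ideal_eq I J.

Lemma ideal_eq_is_ideal : is_ideal J -> is_ideal I.
Proof.
case=> J0 JD JM; split=> [|p q|a p]; first exact/IJ.
  by move=> /IJ ? /IJ ?; apply/IJ/JD.
by move=> /IJ ?; apply/IJ/JM.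
Qed.

Lemma ideal_eq_gorenstein : gorenstein_artinian J -> gorenstein_artinian I.
Proof.
case=> [[[Ji Jh] J1] [s hs] [t [ts nt tu]]]; split.
- split; last by move/IJ.
  by split=> [|p d /IJ Jp]; [apply: ideal_eq_is_ideal | apply/IJ/Jh].
- by exists s => p; have [c hc] := hs p; exists c; apply/IJ.
exists t; split=> [i| /IJ //|p hp]; first exact/IJ.
by have [|c hc] := tu p; [move=> i; apply/IJ | exists c; apply/IJ].
Qed.

Lemma ideal_eq_socle_degree d : socle_degree J d -> socle_degree I d.
Proof.
case=> [[p [hp nJ]] h]; split; first by exists p; split=> // /IJ.
by move=> e q lt hq; apply/IJ/(h e).
Qed.

Lemma ideal_eq_WLP : WLP J -> WLP I.
Proof.
case=> L [hL h]; exists L; split=> // d; case: (h d) => [inj|sur]; [left|right].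
  by move=> p hp /IJ JLp; apply/IJ/inj.
by move=> q /sur[p [hp Jp]]; exists p; split=> //; apply/IJ.
Qed.

End Extensionality.

Lemma colon_eq (T : comNzRingType) (I J : T -> Prop) x :
  ideal_eq I J -> ideal_eq (colon I x) (colon J x).
Proof. by move=> h p; apply: h. Qed.

(** * Minimal generation by three elements *)

Lemma minimally_generated_by3 (T : comNzRingType) (a b c : T) (I : T -> Prop) :
  ~ ideal_of [:: b; c] a -> ~ ideal_of [:: a; c] b -> ~ ideal_of [:: a; b] c ->
  ideal_eq (ideal_of [:: a; b; c]) I -> minimally_generated_by 3 I.
Proof.
move=> na nb nc hI; exists [tuple a; b; c]; split=> // x.
rewrite /= !inE => xs h.
have Ix : ideal_of (rem x [:: a; b; c]) x.
  by apply/h/hI/mem_ideal_of; rewrite !inE.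
(* The non-memberships also force the generators to be distinct, so [rem] deletes the intended
   one. *)
have ab : a == b = false.
  by apply/negP => /eqP e; apply: na; rewrite e; apply: mem_ideal_of; rewrite !inE eqxx.
have ac : a == c = false.
  by apply/negP => /eqP e; apply: na; rewrite e; apply: mem_ideal_of; rewrite !inE eqxx orbT.
have bc : b == c = false.
  by apply/negP => /eqP e; apply: nb; rewrite e; apply: mem_ideal_of; rewrite !inE eqxx orbT.
by case/or3P: xs Ix => /eqP -> /=; rewrite ?eqxx ?ab ?ac ?bc ?eqxx.
Qed.

Lemma notin_ideal_of_meval (K : fieldType) n (v : 'I_n -> K)
    (gs : seq {mpoly K[n]}) (p : {mpoly K[n]}) :
  (forall q, q \in gs -> q.@[v] = 0) -> p.@[v] != 0 -> ~ ideal_of gs p.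
Proof.
move=> gs0 /eqP p0 /(ideal_of_sub (I := fun q => q.@[v] = 0)); apply: contra_not p0; apply.
  split=> [|q q' e e'|a q e]; first exact: meval0.
    by rewrite mevalD e e' addr0.
  by rewrite mevalM e mulr0.
exact: gs0.
Qed.

(** At each of the three coordinate points exactly one generator is nonzero; this uses that [mu] and
    [nu] are positive. *)
Lemma I_tilde_minimal (K : fieldType) (gam2 gam3 gam4 mu nu : nat) (I : {mpoly K[3]} -> Prop) :
  (0 < mu)%N -> (0 < nu)%N ->
  ideal_eq (I_tilde K gam2 gam3 gam4 mu nu) I -> minimally_generated_by 3 I.
Proof.
move=> mu0 nu0; pose e (i j : 'I_3) : K := (i == j)%:R.
have ne i j : (i < 3)%N -> (j < 3)%N -> i != j -> e (inord i) (inord j) = 0.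
  by move=> hi hj /negPf nij; rewrite /e -val_eqE /= !inordK // nij.
have ee i : e i i = 1 by rewrite /e eqxx.
apply: minimally_generated_by3.
- apply: (notin_ideal_of_meval (v := e (inord 0))) => [q|]; last first.
    by rewrite rmorphXn /= mevalXU ee expr1n oner_neq0.
  by rewrite !inE => /orP[] /eqP ->; rewrite ?mevalB ?mevalM !rmorphXn /= !mevalXU
    ?(ne 0%N 1%N) ?(ne 0%N 2%N) // ?expr0n /= ?(gtn_eqF nu0) ?mulr0 ?subr0.
- apply: (notin_ideal_of_meval (v := e (inord 1))) => [q|]; last first.
    by rewrite mevalB mevalM !rmorphXn /= !mevalXU ee expr1n (ne 1%N 0%N) // expr0n
      (gtn_eqF mu0) mul0r subr0 oner_neq0.
  by rewrite !inE => /orP[] /eqP ->; rewrite !rmorphXn /= !mevalXU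
    ?(ne 1%N 0%N) ?(ne 1%N 2%N) // ?expr0n.
apply: (notin_ideal_of_meval (v := e (inord 2))) => [q|]; last first.
  by rewrite rmorphXn /= mevalXU ee expr1n oner_neq0.
by rewrite !inE => /orP[] /eqP ->; rewrite ?mevalB ?mevalM !rmorphXn /= !mevalXU
    ?(ne 2%N 1%N) ?(ne 2%N 0%N) // ?expr0n /= ?(gtn_eqF mu0) ?mul0r ?subr0.
Qed.

(** * Four generators *)

Section FourGenerators.
Local Open Scope nat_scope.
Variables g1 g2 g3 g4 gam2 gam3 gam4 mu nu : nat.
Let g : 4.-tuple nat := [tuple g1; g2; g3; g4].
Hypothesis g_min : minimal_generators g.
Hypothesis g_pure : M_pure_symmetric g.
Hypothesis gamma2 : is_gamma g g2 gam2.
Hypothesis gamma3 : is_gamma g g3 gam3.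
Hypothesis gamma4 : is_gamma g g4 gam4.
Hypothesis relation : gam3.+1 * g3 = mu * g2 + nu * g4.
Hypothesis mu_nu : mu + nu = gam3.+1.

Local Notation key := (apery_key g).
Local Notation nf := (nf gam2 gam3 gam4 mu nu).
Let gkG := nf_gorenstein gam2 gam4 mu_nu.

Let g_gt0 : forall i, 0 < tnth g i. Proof. by case: g_min. Qed.

Let g_lt : (g2 < g3) && (g3 < g4).
Proof. by case: g_min => /= /and4P[_ -> ->]. Qed.

Let g_tnth : ((tnth g (lift ord0 (inord 0 : 'I_3)) = g2) *
  (tnth g (lift ord0 (inord 1 : 'I_3)) = g3) * (tnth g (lift ord0 (inord 2 : 'I_3)) = g4))%type.
Proof. by rewrite !(tnth_nth 0) /= /bump /= !inordK. Qed.

Let wtE i j k : wt g (mon i j k) = i * g2 + j * g3 + k * g4.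
Proof.
rewrite mon.unlock !wtD !wt1.
by rewrite !g_tnth.
Qed.

Let Uy h : (U_(inord 0) *+ h)%MM = mon h 0 0.
Proof. by rewrite mon.unlock !mulm0n !addm0. Qed.
Let Uz h : (U_(inord 1) *+ h)%MM = mon 0 h 0.
Proof. by rewrite mon.unlock !mulm0n addm0 add0m. Qed.
Let Uw h : (U_(inord 2) *+ h)%MM = mon 0 0 h.
Proof. by rewrite mon.unlock !mulm0n !add0m. Qed.

Let gamma_y : is_gamma g (tnth g (lift ord0 (inord 0 : 'I_3))) gam2.
Proof. by rewrite g_tnth. Qed.
Let gamma_z : is_gamma g (tnth g (lift ord0 (inord 1 : 'I_3))) gam3.
Proof. by rewrite g_tnth. Qed.
Let gamma_w : is_gamma g (tnth g (lift ord0 (inord 2 : 'I_3))) gam4.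
Proof. by rewrite g_tnth. Qed.

Let key_y : key (mon gam2 0 0) != None.
Proof. by rewrite -Uy gamma_key. Qed.
Let key_w : key (mon 0 0 gam4) != None.
Proof. by rewrite -Uw gamma_key. Qed.

(** As [g2] is the smallest of the three weights, a power of y is the only monomial of its degree
    and weight, and [gamma_next] applies. The same holds for w, which has the largest weight. *)
Let key_y_next : key (mon gam2.+1 0 0) = None.
Proof.
rewrite -Uy; apply: gamma_next => // m; rewrite [m]mon_eta mdeg_mon wtE g_tnth Uy.
case/andP: g_lt; set i := m _; set j := m _; set k := m _ => h1 h2 hd hw.
have : j * (g3 - g2) + k * (g4 - g2) = 0 by nia.
move/eqP; rewrite addn_eq0 !muln_eq0 !subn_eq0 leqNgt h1 leqNgt (ltn_trans h1 h2) !orbF.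
by move=> /andP[/eqP j0 /eqP k0]; congr mon => //; lia.
Qed.

Let key_w_next : key (mon 0 0 gam4.+1) = None.
Proof.
rewrite -Uw; apply: gamma_next => // m; rewrite [m]mon_eta mdeg_mon wtE g_tnth Uw.
case/andP: g_lt; set i := m _; set j := m _; set k := m _ => h1 h2 hd hw.
have : j * (g4 - g3) + i * (g4 - g2) = 0 by nia.
move/eqP; rewrite addn_eq0 !muln_eq0 !subn_eq0 leqNgt h2 leqNgt (ltn_trans h1 h2) !orbF.
by move=> /andP[/eqP j0 /eqP i0]; congr mon => //; lia.
Qed.

(** By [relation] and [mu_nu], the rewriting rule preserves weight and degree. *)
Let key_reduce (m : 'X_{1..3}) (q := m (inord 1) %/ gam3.+1) :
  key m = key (mon (m (inord 0) + q * mu) (m (inord 1) %% gam3.+1) (m (inord 2) + q * nu)).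
Proof.
have e := divn_eq (m (inord 1)) gam3.+1; rewrite -/q in e.
apply: eq_apery_key; rewrite [X in _ X = _]mon_eta ?wtE ?mdeg_mon {1}e.
  rewrite !mulnDl -mulnA relation mulnDr; lia.
by rewrite -mu_nu mulnDr; lia.
Qed.

Let key_nf_none m : nf m = None -> key m = None.
Proof.
rewrite key_reduce /nf; set q := m (inord 1) %/ gam3.+1.
case: ifP => // /negbT; rewrite negb_and -!ltnNge => /orP[] h _.
  by rewrite -(subnK h) -[X in mon _ X]addn0 -[X in mon _ _ X]addn0 -monD apery_key_absorb.
by rewrite -(subnK h) -[X in mon X]addn0 -[X in mon _ X]addn0 -monD apery_key_absorb.
Qed.

Let key_nf m i j k : nf m = Some (i, j, k) -> key m = key (mon i j k).
Proof. by rewrite key_reduce /nf; case: ifP => // _ [<- <- <-]. Qed.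

(* Cancelling the common factor of two distinct maximal representations leaves
   z^d on one side and a monomial in y and w on the other; then z^gam3 has a
   second maximal representation. *)
Let key_inj_le i j k i' j' k' : j <= j' -> j' <= gam3 ->
  key (mon i j k) = key (mon i' j' k') -> key (mon i j k) != None ->
  (i, j, k) = (i', j', k').
Proof.
move=> le_jj' hj' h h0; have [] := apery_key_eq h h0; rewrite !wtE !mdeg_mon => ew ed.
(* In terms of the gaps [a = g3 - g2] and [c = g4 - g3], equality of degrees removes [g2] from the
   equation of weights. *)
have [a [c [a_gt0 e3 e4]]] : exists a c, [/\ 0 < a, g3 = g2 + a & g4 = g2 + (a + c)].
  case/andP: g_lt => lt23 lt34; exists (g3 - g2), (g4 - g3).
  by split; [rewrite subn_gt0 | lia | lia].
have [d ed'] : exists d, j' = j + d by exists (j' - j); rewrite subnKC.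
have {}ew : k * (a + c) = d * a + k' * (a + c).
  by move: ew ed; rewrite e3 e4 ed'; nia.
have le_k : k' <= k.
  by rewrite -(@leq_pmul2r (a + c)) ?addn_gt0 ?a_gt0 // ew leq_addl.
have [p ek] : exists p, k = k' + p by exists (k - k'); rewrite subnKC.
have {}ew : p * (a + c) = d * a by move: ew; rewrite ek mulnDl; lia.
have le_p : p <= d by rewrite -(@leq_pmul2r a) // -ew leq_mul2l leq_addr orbT.
(* Here y^(d-p) w^p has the weight and degree of z^d; times z^(gam3-d) it rivals z^gam3, so
   uniqueness forces [d = p = 0]. *)
have := gamma_unique g_gt0 gamma_z (m := mon (d - p) (gam3 - d) p).
rewrite mdeg_mon wtE g_tnth Uz => E.
have {}E : mon (d - p) (gam3 - d) p = mon 0 gam3 0.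
  apply: E; first by lia.
  have [r er] : exists r, gam3 = d + r by exists (gam3 - d); lia.
  have [t et] : exists t, d = p + t by exists (d - p); lia.
  by rewrite er addKn et addKn e3 e4; move: ew; rewrite et; nia.
have := congr1 (fun m : 'X_{1..3} => m (inord 2)) E.
have := congr1 (fun m : 'X_{1..3} => m (inord 0)) E.
rewrite /= !monE => d0 p0.
by congr (_, _, _); lia.
Qed.

Let key_inj i j k i' j' k' : j <= gam3 -> j' <= gam3 ->
  key (mon i j k) = key (mon i' j' k') -> key (mon i j k) != None ->
  (i, j, k) = (i', j', k').
Proof.
move=> hj hj' h h0; have [le|/ltnW le] := leqP j j'; first exact: key_inj_le.
by apply/esym/key_inj_le; rewrite -?h.
Qed.

Let key_nf_inj m m' : key m = key m' -> key m != None -> nf m = nf m'.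
Proof.
move=> h h0; case E: (nf m) => [[[i j] k]|]; last by rewrite key_nf_none in h0.
case E': (nf m') => [[[i' j'] k']|]; last by rewrite h key_nf_none in h0.
congr Some; have [_ hj _] := nf_some E; have [_ hj' _] := nf_some E'.
by apply: key_inj; rewrite // -(key_nf E) -?(key_nf E').
Qed.

Lemma apery_top : exists2 beta, beta <= gam3 &
  gorenstein_key key (mon gam2 beta gam4).
Proof.
have [t gk] := apery_gorenstein g_gt0 g_pure; have t0 := gk_top gk.
case E: (nf t) => [[[i j] k]|]; last by rewrite key_nf_none in t0.
have [hi hj hk] := nf_some E.
have [u hu] := gk_divides gk key_y; have [v hv] := gk_divides gk key_w.
(* The rule never lowers the [y]-exponent, so the normal form of a multiple of y^gam2 keeps at least
   [gam2]; likewise for w below. *)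
have ei : i = gam2.
  have Eu : nf (u + mon gam2 0 0)%MM = Some (i, j, k).
    by rewrite -E; apply: key_nf_inj; rewrite hu.
  move: Eu; rewrite /nf; case: ifP => // _ [ei _ _]; apply/eqP; rewrite eqn_leq hi.
  by rewrite -ei mnmDE monE -addnA addnCA leq_addr.
have ek : k = gam4.
  have Ev : nf (v + mon 0 0 gam4)%MM = Some (i, j, k).
    by rewrite -E; apply: key_nf_inj; rewrite hv.
  move: Ev; rewrite /nf; case: ifP => // _ [_ _ ek]; apply/eqP; rewrite eqn_leq hk.
  by rewrite -ek mnmDE monE -addnA addnCA leq_addr.
exists j => //; have Et := key_nf E; rewrite ei ek in Et.
case: gk => absorb cong cancel deg _ div; split=> //; first by rewrite -Et.
by move=> m /div[x hx]; exists x; rewrite hx.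
Qed.

(** * The ideal of A as a colon ideal *)

Section Colon.
Variable beta : nat.
Hypothesis beta_le : beta <= gam3.
Hypothesis gkA : gorenstein_key key (mon gam2 beta gam4).
Let C := gam3 - beta.
Let keyC m := nf (mon 0 C 0 + m)%MM.

Let C_top : keyC (mon gam2 beta gam4) = nf (mon gam2 gam3 gam4).
Proof. by rewrite /keyC monD !add0n subnK. Qed.

Let C_top_some : nf (mon gam2 gam3 gam4) = Some (gam2, gam3, gam4).
Proof. exact: nf_box. Qed.

(** The product of z^C and the top of A is the top of G. If z^C m is nonzero it divides the latter,
    and cancelling z^C makes m divide the top of A; conversely, multiply by z^C. *)
Let key_colon_none m : (key m == None) = (keyC m == None).
Proof.
case E: (nf m) => [e|]; last by rewrite /keyC nf_absorb // key_nf_none.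
apply/idP/idP; apply: contraTT => h.
- have [u hu] := gk_divides gkG h.
  have {}hu : nf (mon 0 C 0 + (u + m))%MM = nf (mon 0 C 0 + mon gam2 beta gam4)%MM.
    by rewrite addmA [(mon 0 C 0 + u)%MM]addmC -addmA hu -C_top.
  have {}hu : nf (u + m)%MM = nf (mon gam2 beta gam4).
    by apply: (gk_cancel gkG) (hu) _; rewrite hu -/(keyC _) C_top C_top_some.
  apply: contra_neq (gk_top gkA) => km.
  rewrite nf_box // in hu.
  by rewrite -(key_nf hu); apply: apery_key_absorb.
have [u hu] := gk_divides gkA h.
have {}hu : nf (u + m)%MM = nf (mon gam2 beta gam4).
  by apply: key_nf_inj; rewrite hu // (gk_top gkA).
have := gk_cong gkG (mon 0 C 0) hu; rewrite -/(keyC (mon _ _ _)) C_top C_top_some.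
by rewrite addmA [(mon 0 C 0 + u)%MM]addmC -addmA => hm; apply/negP => /eqP /(nf_absorb u); rewrite hm.
Qed.

(** On monomials that are nonzero in A, equal keys mean equal normal forms, and z^C cancels in G. *)
Let key_colon_eq m m' : key m != None -> (key m == key m') = (keyC m == keyC m').
Proof.
move=> h; apply/eqP/eqP => [e | e].
  by apply: (gk_cong gkG); apply: key_nf_inj.
have hC : keyC m != None by rewrite -key_colon_none.
have := gk_cancel gkG e hC; case E: (nf m) => [[[i j] k]|] E'.
  by rewrite (key_nf E) (key_nf (esym E')).
by rewrite key_nf_none in h.
Qed.

Variable K : fieldType.
Local Open Scope ring_scope.
Local Notation I := (apery_ideal K g).
Local Notation It := (I_tilde K gam2 gam3 gam4 mu nu).

Let I_key : ideal_eq I (key_ideal keyC).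
Proof.
apply: ideal_eq_trans (apery_ideal_key g_gt0) _.
exact: (eq_key_ideal key_colon_none key_colon_eq).
Qed.

Let It_key : ideal_eq It (key_ideal nf).
Proof. exact: I_tilde_key. Qed.

Let Xz i : (vz : {mpoly K[3]}) ^+ i = 'X_[mon 0 i 0].
Proof. by rewrite mpolyX_mon !expr0 mulr1 mul1r. Qed.
Let Xzy i j : (vz : {mpoly K[3]}) ^+ i * vy ^+ j = 'X_[mon j i 0].
Proof. by rewrite mpolyX_mon expr0 mulr1 mulrC. Qed.
Let Xzw i k : (vz : {mpoly K[3]}) ^+ i * vw ^+ k = 'X_[mon 0 i k].
Proof. by rewrite mpolyX_mon expr0 mul1r. Qed.

Lemma apery_colon : ideal_eq I (colon It (vz ^+ C)).
Proof.
apply: ideal_eq_trans I_key _; rewrite Xz.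
apply: ideal_eq_sym; apply: ideal_eq_trans (colon_eq _ It_key) _.
exact: colon_key_ideal.
Qed.

Lemma apery_not_ci : (0 < mu)%N -> (0 < nu)%N ->
  ~ minimally_generated_by 3 I -> (0 < C)%N.
Proof.
move=> mu0 nu0 nci; rewrite lt0n; apply/eqP => C0; apply: nci.
apply: (I_tilde_minimal mu0 nu0 (gam2 := gam2) (gam3 := gam3) (gam4 := gam4)) => p.
by rewrite apery_colon /colon C0 expr0 mul1r.
Qed.

Lemma apery_socle_degree : socle_degree I (gam2 + gam3 + gam4 - C)%N.
Proof.
have -> : (gam2 + gam3 + gam4 - C = mdeg (mon gam2 beta gam4))%N.
  by rewrite mdeg_mon /C; lia.
apply: (ideal_eq_socle_degree (apery_ideal_key g_gt0)).
exact: key_socle_degree.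
Qed.

(** For a box monomial of exponents [i], [j], [k], the product by z^C vanishes in G exactly when
    [C + j] exceeds [gam3], that is [h3 <= j], and the rewriting pushes y or w out of the box, that
    is [h2 <= i] or [h4 <= k]. *)
Lemma apery_generators (h2 := (gam2 - mu + 1)%N) (h3 := (gam3 + 1 - C)%N)
    (h4 := (gam4 - nu + 1)%N) :
  (mu <= gam2)%N -> (nu <= gam4)%N ->
  ideal_eq I (ideal_add It (ideal_of [:: vz ^+ h3 * vy ^+ h2; vz ^+ h3 * vw ^+ h4])).
Proof.
move=> mu_le nu_le; have Iti : is_ideal It := ideal_of_is_ideal _.
set gens := [:: _; _]; have gi : is_ideal (ideal_of gens) := ideal_of_is_ideal _.
have Si := ideal_add_is_ideal Iti gi; have [S0 SD SM] := Si.
have C_le : (C <= gam3)%N by apply: leq_subr.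
have Ii : is_ideal I by apply: ideal_eq_is_ideal (apery_ideal_key g_gt0) (key_ideal_is_ideal K gkA).
move=> p; split=> [/I_key pI|]; last first.
  apply: ideal_add_sub => // {}p.
    move=> pIt; apply/apery_colon; case: Iti => _ _; exact.
  apply: ideal_of_sub => // x; rewrite !inE => /orP[] /eqP ->; apply/I_key.
    rewrite Xzy; apply/key_idealX; rewrite /keyC monD /nf !monE /h3 subnKC; last by lia.
    by rewrite addn1 divnn /= mul1n; case: ifP => //; rewrite /h2; lia.
  rewrite Xzw; apply/key_idealX; rewrite /keyC monD /nf !monE /h3 subnKC; last by lia.
  by rewrite addn1 divnn /= mul1n; case: ifP => //; rewrite /h4; lia.
apply: (key_ideal_sub S0 SD (is_idealZ Si) _ _ pI) => [m hm|m m' e ne]; last first.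
  apply: ideal_addl => //; apply/It_key; apply: key_idealB.
  exact: (gk_cancel gkG e ne).
case E: (nf m) => [[[i j] k]|]; last by apply: ideal_addl => //; apply/It_key/key_idealX.
have [hi hj hk] := nf_some E.
rewrite -[X in ideal_add _ _ X](subrK 'X_[mon i j k]); apply: (SD).
  by apply: ideal_addl => //; apply/It_key/key_idealB; rewrite E nf_box.
move: hm; rewrite /keyC (nf_reduce _ E) monD !add0n /nf !monE.
have [lt|le] := ltnP (C + j) gam3.+1; first by rewrite divn_small // !mul0n !addn0 hi hk.
(* Both [C] and [j] are at most [gam3], so the rule applies exactly once. *)
have -> : ((C + j) %/ gam3.+1 = 1)%N.
  by rewrite -(subnK le) divnDr // divnn /= divn_small //; lia.
rewrite !mul1n; case: ifP => // /negbT; rewrite negb_and -!ltnNge => h _.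
have h3j : (h3 <= j)%N by rewrite /h3; lia.
have gensE : gens = [:: 'X_[mon h2 h3 0]; 'X_[mon 0 h3 h4]] by rewrite /gens Xzy Xzw.
apply: ideal_addr => //; case: gi => _ _ gM; case/orP: h => h.
  have h2i : (h2 <= i)%N by rewrite /h2; lia.
  rewrite -(subnK h2i) -(subnK h3j) -[X in mon _ _ X]addn0 -monD mpolyXD.
  by apply: gM; apply: mem_ideal_of; rewrite gensE !inE eqxx.
have h4k : (h4 <= k)%N by rewrite /h4; lia.
rewrite -(subnK h4k) -(subnK h3j) -[X in mon X]addn0 -monD mpolyXD.
by apply: gM; apply: mem_ideal_of; rewrite gensE !inE eqxx orbT.
Qed.

Lemma apery_quotient_condition : [pchar K] =i pred0 -> quotient_condition I.
Proof.
move=> K0; split.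
  exact: ideal_eq_gorenstein (apery_ideal_key g_gt0) (key_gorenstein K gkA).
exists It, (inord 1), C; split; last exact: apery_colon.
  exact: ideal_eq_gorenstein It_key (key_gorenstein K gkG).
exact: ideal_eq_WLP It_key (nf_WLP K0 _ _ mu_nu).
Qed.

End Colon.

End FourGenerators.

Theorem theorem5p6 (K : fieldType) (g1 g2 g3 g4 : nat)
    (gam2 gam3 gam4 mu2 mu4 : nat) :
  let Sg : 4.-tuple nat := [tuple g1; g2; g3; g4] in
  let I : {mpoly K[3]} -> Prop := apery_ideal K Sg in
  let It : {mpoly K[3]} -> Prop := I_tilde K gam2 gam3 gam4 mu2 mu4 in
  [pchar K] =i pred0 ->
  minimal_generators Sg ->
  M_pure_symmetric Sg ->
  ~ minimally_generated_by 3 I ->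
  is_gamma Sg g2 gam2 -> is_gamma Sg g3 gam3 -> is_gamma Sg g4 gam4 ->
  (gam3.+1 * g3 = mu2 * g2 + mu4 * g4)%N ->
  in_apery Sg (gam3.+1 * g3) ->
  (1 <= mu2 <= gam2)%N -> (1 <= mu4 <= gam4)%N ->
  (mu2 + mu4 = gam3.+1)%N ->
  exists C D : nat,
    [/\ (0 < C <= D)%N, socle_degree It D & socle_degree I (D - C)] /\
    let h2 := (gam2 - mu2 + 1)%N in
    let h3 := (gam3 + 1 - C)%N in
    let h4 := (gam4 - mu4 + 1)%N in
    [/\ (C <= gam3 + 1)%N,
        ideal_eq I
          (ideal_add It (ideal_of [:: vz ^+ h3 * vy ^+ h2; vz ^+ h3 * vw ^+ h4])),
        ideal_eq I (colon It (vz ^+ C))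
      & quotient_condition I].
Proof.
move=> Sg I It K0 g_min g_pure nci gamma2 gamma3 gamma4 rel _.
move=> /andP[mu_gt0 mu_le] /andP[nu_gt0 nu_le] mu_nu.
have [beta beta_le gkA] := apery_top g_min g_pure gamma2 gamma3 gamma4 rel mu_nu.
have C_gt0 := apery_not_ci g_min gamma2 gamma3 gamma4 rel mu_nu beta_le gkA mu_gt0 nu_gt0 nci.
(* Here [beta] is the [z]-exponent of the top monomial of A, and [D] is the degree of the top
   monomial of G. *)
exists (gam3 - beta)%N, (gam2 + gam3 + gam4)%N; split.
  split.
  - by rewrite C_gt0 /=; lia.
  - have It_key : ideal_eq It (key_ideal (nf gam2 gam3 gam4 mu2 mu4)) by exact: I_tilde_key.
    apply: (ideal_eq_socle_degree It_key).
    by rewrite -mdeg_mon; apply/key_socle_degree/nf_gorenstein.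
  - exact: (apery_socle_degree g_min gamma2 gamma4 rel mu_nu beta_le gkA K).
split.
- by lia.
- exact: (apery_generators g_min gamma2 gamma3 gamma4 rel mu_nu beta_le gkA mu_le nu_le).
- exact: (apery_colon g_min gamma2 gamma3 gamma4 rel mu_nu beta_le gkA).
- exact: (apery_quotient_condition g_min gamma2 gamma3 gamma4 rel mu_nu beta_le gkA K0).
Qed.
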